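(* Let $(u_n,\Psi _n)$ be a sequence of solutions satisfying \begin{equation*} \left\{ \begin{array}{rcl} -\Delta u_n(x) &=& 2V^2(x)|x|^{2\alpha_n}e^{2u_n(x)}-V(x)|x|^{\alpha_n}e^{u_n(x)}|\Psi_n|^2 \quad\\ \not{D}\Psi_n &=& -V(x)|x|^{\alpha_n}e^{u_n(x)}\Psi_n \end{array} \text {in } B_{r}, \right. \end{equation*} with the energy condition \begin{equation*} \int_{B_r}|x|^{2\alpha_n}e^{2u_n}dx<C,\text{ and }\int_{B_r}\left| \Psi _n\right| ^4dx<C. \end{equation*} for some constant $C>0$. Assume that \begin{itemize} \item[i)] $\alpha_n \in \mathbb{R} ^+, \alpha_n \rightarrow \alpha$ with $\alpha\geq 0$, \item[ii)] $V \in C^{1,\beta}(B_r), 0< a\leq V(x)\leq b < + \infty$. \end{itemize} Define \[\begin{array}{rcl} \Sigma _1&=&\left\{ x\in B_r,\text{ there is a sequence }y_n\rightarrow x\text{ such that }u_n(y_n)\rightarrow +\infty \right\}\\ \Sigma _2&=&\left\{ x\in B_r,\text{ there is a sequence }y_n\rightarrow x\text{ such that }\left| \Psi _n(y_n)\right| \rightarrow +\infty \right\} .\end{array} \] Then, we have $\Sigma_2\subset\Sigma_1$. Moreover, $(u_n,\Psi _n)$ admits a subsequence, still denoted by $( u_n,\Psi _n),$ satisfying \begin{enumerate} \item[a)] $\Psi _n$ is bounded in $ L_{loc}^{\infty} (B_r\backslash \Sigma _2)$ . \item[b)] For $u_n$, one of the following alternatives holds: \begin{enumerate} \item[i)] $u_n$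 is bounded in $L^{\infty}_{loc} (B_r).$ \item[ii)] $u_n$ $\rightarrow -\infty $ uniformly on compact subsets of $B_r$. \item[iii)] $\Sigma _1$ is finite, nonempty and either $u_n$ is bounded in $L_{loc}^\infty (B_r\backslash \Sigma _1)$ or $u_n\rightarrow -\infty$ uniformly on compact subsets of $B_r\backslash \Sigma _1$. \end{enumerate} \end{enumerate}
   Context: $B_r=B_r(0)$ is a disc in $\mathbb{R}^2$. $u_n$ are real-valued functions, $\Psi_n:B_r\to\mathbb{C}^2$ are spinor fields, and $\not{D}$ denotes the standard Dirac operator on $\mathbb{R}^2$: for $\Psi=(f,g)^T$, $\not{D}\Psi = 2\left(\frac{\partial g}{\partial \bar z}, -\frac{\partial f}{\partial z}\right)^T$ with $\frac{\partial}{\partial z}=\frac12(\partial_{x_1}-i\partial_{x_2})$, $\frac{\partial}{\partial \bar z}=\frac12(\partial_{x_1}+i\partial_{x_2})$. *)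

(* Defs.v *)
From HB Require Import structures.
From mathcomp Require Import all_boot all_order all_algebra.
From mathcomp Require Import all_classical all_reals all_analysis.
From mathcomp Require Import complex.
Import Order.TTheory GRing.Theory Num.Theory.
Import numFieldNormedType.Exports.

Set Implicit Arguments.
Unset Strict Implicit.
Unset Printing Implicit Defensive.

Local Open Scope classical_set_scope.
Local Open Scope ring_scope.

Section Defs.
Variable R : realType.

Definition enorm (p : R * R) : R := Num.sqrt (p.1 ^+ 2 + p.2 ^+ 2).

Definition disc (r : R) : set (R * R) := [set p | enorm p < r].

(** |x|^s (with the convention 0^s = 0 for s <> 0, 0^0 = 1, as for powR). *)
Definition wt (s : R) (p : R * R) : R := enorm p `^ s.

Definition partial1 (f : R * R -> R) (p : R * R) : R :=
  derive1 (fun t => f (t, p.2)) p.1.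
Definition partial2 (f : R * R -> R) (p : R * R) : R :=
  derive1 (fun t => f (p.1, t)) p.2.

Definition C1_on (U : set (R * R)) (f : R * R -> R) : Prop :=
  forall p, U p ->
    [/\ {for p, continuous f},
        derivable (fun t => f (t, p.2)) p.1 1,
        derivable (fun t => f (p.1, t)) p.2 1,
        {for p, continuous (partial1 f)} &
        {for p, continuous (partial2 f)}].

Definition C2_on (U : set (R * R)) (f : R * R -> R) : Prop :=
  [/\ C1_on U f, C1_on U (partial1 f) & C1_on U (partial2 f)].

Definition C1beta_on (U : set (R * R)) (beta : R) (f : R * R -> R) : Prop :=
  C1_on U f /\
  forall K, compact K -> K `<=` U ->
    exists M : R, forall x y, K x -> K y ->
      `|partial1 f x - partial1 f y| <= M * enorm (x - y) `^ beta /\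
      `|partial2 f x - partial2 f y| <= M * enorm (x - y) `^ beta.

Definition laplacian (f : R * R -> R) (p : R * R) : R :=
  partial1 (partial1 f) p + partial2 (partial2 f) p.

Definition cpartial1 (h : R * R -> R[i]) (p : R * R) : R[i] :=
  Complex (partial1 (fun q => complex.Re (h q)) p) (partial1 (fun q => complex.Im (h q)) p).
Definition cpartial2 (h : R * R -> R[i]) (p : R * R) : R[i] :=
  Complex (partial2 (fun q => complex.Re (h q)) p) (partial2 (fun q => complex.Im (h q)) p).

Definition CC1_on (U : set (R * R)) (h : R * R -> R[i]) : Prop :=
  C1_on U (fun q => complex.Re (h q)) /\ C1_on U (fun q => complex.Im (h q)).

Definition imag_unit : R[i] := Complex 0 1.

Definition dz (h : R * R -> R[i]) (p : R * R) : R[i] :=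
  2^-1 * (cpartial1 h p - imag_unit * cpartial2 h p).
Definition dzbar (h : R * R -> R[i]) (p : R * R) : R[i] :=
  2^-1 * (cpartial1 h p + imag_unit * cpartial2 h p).

Definition Dirac (Psi : R * R -> R[i] * R[i]) (p : R * R) : R[i] * R[i] :=
  (2 * dzbar (fun q => (Psi q).2) p, - (2 * dz (fun q => (Psi q).1) p)).

Definition rC (c : R) : R[i] := Complex c 0.

Definition sqmod (z : R[i]) : R := complex.Re z ^+ 2 + complex.Im z ^+ 2.
Definition spin_sq (s : R[i] * R[i]) : R := sqmod s.1 + sqmod s.2.
Definition spin_norm (s : R[i] * R[i]) : R := Num.sqrt (spin_sq s).

Definition is_solution (r : R) (V : R * R -> R) (al : R)
    (u : R * R -> R) (Psi : R * R -> R[i] * R[i]) : Prop :=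
  [/\ C2_on (disc r) u,
      CC1_on (disc r) (fun q => (Psi q).1),
      CC1_on (disc r) (fun q => (Psi q).2) &
      forall x, disc r x ->
        - laplacian u x =
          2 * V x ^+ 2 * wt (2 * al) x * expR (2 * u x)
          - V x * wt al x * expR (u x) * spin_sq (Psi x)
        /\
        Dirac Psi x =
          (rC (- (V x * wt al x * expR (u x))) * (Psi x).1,
           rC (- (V x * wt al x * expR (u x))) * (Psi x).2)].

Definition leb2 := ((@lebesgue_measure R) \x (@lebesgue_measure R))%E.

Definition Sigma1 (r : R) (u : nat -> R * R -> R) : set (R * R) :=
  [set x | disc r x /\
     exists y : nat -> R * R,
       y @ \oo --> x /\ (fun n => u n (y n)) @ \oo --> +oo].

Definition Sigma2 (r : R) (Psi : nat -> R * R -> R[i] * R[i]) : set (R * R) :=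
  [set x | disc r x /\
     exists y : nat -> R * R,
       y @ \oo --> x /\ (fun n => spin_norm (Psi n (y n))) @ \oo --> +oo].

Definition bounded_loc (U : set (R * R)) (F : nat -> R * R -> R) : Prop :=
  forall K, compact K -> K `<=` U ->
    exists M : R, forall n x, K x -> `|F n x| <= M.

Definition to_minfty_loc (U : set (R * R)) (F : nat -> R * R -> R) : Prop :=
  forall K, compact K -> K `<=` U ->
    forall M : R, \forall n \near \oo, forall x, K x -> F n x < M.

End Defs.

(* Main.v *)
(** The spinor term of the first equation has a favourable sign: dropping it, u is a subsolution,
    [- Delta u <= c e^(2u)].  At the maximum x0 of [(d - |x - p|)^2 e^(2u)] on a square, e^(2u) is
    comparable to its value at x0 on a square of size s around x0, so if [c s^2 e^(2u(x0))] is not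
    small the mean value inequality at scale [c^(-1/2) e^(-u(x0))] and [e^t >= 1 + t] force an
    amount of energy independent of everything.  Hence u is bounded above wherever the energy is
    small; away from the origin the weight is almost constant on small squares, with a threshold
    that does not depend on the point, so the blow-up set is finite.  Where u is bounded above,
    the same point picking bounds Psi: for the Dirac equation the mean value inequality follows from the
    Cauchy-Riemann form of the equation and needs only first derivatives of Psi.  The Laplacian
    of u is then locally bounded off the blow-up set, where Harnack's inequality and the
    connectedness of a disc minus finitely many points give the alternative.

    Mean values are taken against the radial weight [eta = ((1 - |y|^2)_+)^2] on a square: the
    derivative in t of the average of u(x + t y) is transformed by integration by parts, which
    avoids polar coordinates and singular kernels. *)
Require Import Defs.
From HB Require Import structures.
From mathcomp Require Import all_boot all_order all_algebra.
From mathcomp Require Import all_classical all_reals all_analysis.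
From mathcomp Require Import complex measurable_realfun.
From mathcomp Require Import ring lra.
Import Order.TTheory GRing.Theory Num.Theory.
Import numFieldNormedType.Exports.
Local Open Scope classical_set_scope.
Local Open Scope ring_scope.
Set Implicit Arguments.
Unset Strict Implicit.
Unset Printing Implicit Defensive.

(** * Squares in the plane *)

Section BoxTopology.
Variable R : realType.
Implicit Types (p q : R * R) (d : R) (A : set (R * R)).

(** Blow-up at a point is a statement about the whole sequence: its negation bounds the functions on
    a square only for infinitely many [n], while the conclusions ask for bounds on all [n]. A
    diagonal subsequence is therefore extracted, over a countable family of rational squares and for
    [u], [- u] and the spinor norm at once. Along it an upper bound on a rational square either
    holds eventually for one constant or, for every constant, eventually fails. The inclusion of
    [Sigma2] in [Sigma1] concerns the original sequence and is content with infinitely many [n].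

    At the origin the weight vanishes with an exponent that varies with [n], so no energy threshold
    is claimed there; one more point does not affect finiteness.

    The constants are explicit because every estimate has to be uniform in [n]; none is optimal.
    Squares are closed balls of the sup norm and products of intervals at the same time, so
    compactness, Fubini and one-dimensional integration by parts apply to them directly. *)

Definition box p d : set (R * R) :=
  `[p.1 - d, p.1 + d]%classic `*` `[p.2 - d, p.2 + d]%classic.

Lemma boxP p d q : box p d q <-> `|q.1 - p.1| <= d /\ `|q.2 - p.2| <= d.
Proof. by rewrite /box/= !in_itv/= !ler_distl. Qed.

Lemma box_compact p d : compact (box p d).
Proof. by apply: compact_setX; exact: segment_compact. Qed.

Lemma box_center p d : 0 <= d -> box p d p.
Proof. by move=> d0; apply/boxP; rewrite !subrr normr0. Qed.

Lemma sub_box p q d e : `|q.1 - p.1| + e <= d -> `|q.2 - p.2| + e <= d ->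
  box q e `<=` box p d.
Proof.
move=> h1 h2 z /boxP[z1 z2]; apply/boxP; split.
- by have := ler_distD q.1 z.1 p.1; lra.
- by have := ler_distD q.2 z.2 p.2; lra.
Qed.

Lemma box_subr p d e : d <= e -> box p d `<=` box p e.
Proof. by move=> de; apply: sub_box; rewrite subrr normr0 add0r. Qed.

Lemma nbhs_boxP p A : nbhs p A <-> exists2 d, 0 < d & box p d `<=` A.
Proof.
split=> [/nbhs_ballP[d /= d0 dA]|[d d0 dA]].
  exists (d / 2); first by rewrite divr_gt0.
  move=> q /boxP[q1 q2]; apply: dA; split; rewrite /ball/= distrC.
    by rewrite (le_lt_trans q1)// ltr_pdivrMr// ltr_pMr// ltr1n.
  by rewrite (le_lt_trans q2)// ltr_pdivrMr// ltr_pMr// ltr1n.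
apply/nbhs_ballP; exists d => //= q [q1 q2]; apply: dA; apply/boxP.
by split; rewrite distrC ltW.
Qed.

Lemma nbhs_box p d : 0 < d -> nbhs p (box p d).
Proof. by move=> d0; apply/nbhs_boxP; exists d. Qed.

(** A base of neighbourhoods indexed by a countable type. It serves twice: to write open sets as
    countable unions, and to run the diagonal extraction. *)
Definition rbox (j : rat * rat * nat) : set (R * R) :=
  box (ratr j.1.1, ratr j.1.2) j.2.+1%:R^-1.

Lemma rbox_base p A : nbhs p A -> exists j, nbhs p (rbox j) /\ rbox j `<=` A.
Proof.
move=> /nbhs_boxP[d d0 dA].
(* The half-side [1 / (k + 1)] is below [d / 2] and the rational centre lies within half of it from
   [p]: so [p] is interior to the square, and the square stays inside [box p d]. *)
pose k := (Num.trunc (2 / d)).+1.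
have k0 : (0 < k.+1%:R^-1 :> R) by rewrite invr_gt0 ltr0n.
have kd : k.+1%:R^-1 < d / 2.
  rewrite -[d / 2]invrK ltf_pV2 ?posrE ?ltr0n ?invr_gt0 ?divr_gt0//.
  rewrite invf_div (@lt_trans _ _ k%:R)// ?ltr_nat//.
  by rewrite truncnS_gt.
have half : k.+1%:R^-1 / 2 < k.+1%:R^-1 :> R by rewrite ltr_pdivrMr// ltr_pMr// ltr1n.
have lt1 (x : R) : x - k.+1%:R^-1 / 2 < x + k.+1%:R^-1 / 2.
  by rewrite ltrD2l (lt_trans (y := 0)) ?oppr_lt0 ?divr_gt0.
have [q1 /itvP q1P] := rat_in_itvoo (lt1 p.1).
have [q2 /itvP q2P] := rat_in_itvoo (lt1 p.2).
have d1 : `|p.1 - ratr q1| <= k.+1%:R^-1 / 2.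
  by rewrite distrC ler_distl !ltW// q1P.
have d2 : `|p.2 - ratr q2| <= k.+1%:R^-1 / 2.
  by rewrite distrC ler_distl !ltW// q2P.
exists (q1, q2, k); split.
  apply/nbhs_boxP; exists (k.+1%:R^-1 / 2); first by rewrite divr_gt0.
  by apply: sub_box => /=; rewrite [leRHS]splitr lerD2r.
apply: subset_trans dA; apply: sub_box => /=; rewrite distrC.
  by rewrite (splitr d) lerD// ltW// (le_lt_trans d1)// (lt_trans half).
by rewrite (splitr d) lerD// ltW// (le_lt_trans d2)// (lt_trans half).
Qed.

End BoxTopology.

(** * Integration over rectangles *)

Section PlaneIntegral.
Variable R : realType.
Implicit Types (p q : R * R) (d : R) (f F H : R * R -> R).
Notation mu := (@lebesgue_measure R).
Notation mu2 := (mu \x mu)%E.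

Lemma measurable_box p d : measurable (box p d).
Proof. by apply: measurableX; exact: measurable_itv. Qed.

(** The measurable sets of the plane are those of the product sigma-algebra, so an open set is
    exhibited as a countable union of rational squares. *)
Lemma measurable_open_plane (A : set (R * R)) : open A -> measurable A.
Proof.
move=> oA.
have -> : A = \bigcup_(j in [set j | rbox j `<=` A]) rbox j.
  rewrite eqEsubset; split=> [x Ax|x [j /= jA]]; last exact: jA.
  have [j [xj jA]] := rbox_base (open_nbhs_nbhs (conj oA Ax)).
  by exists j => //; exact: nbhs_singleton xj.
rewrite bigcup_mkcond; apply: countable_bigcupT_measurable => [|j].
  exact: countableP.
by case: ifP => _; [exact: measurable_box|exact: measurable0].
Qed.

Lemma measurable_fun_cont (A : set (R * R)) f : measurable A ->
  (forall q, A q -> {for q, continuous f}) -> measurable_fun A f.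
Proof.
move=> mA cf; apply: (measurability _ (measurable_realfun.RGenOpens.measurableE R)).
move=> _ [_ [a [b ->] <-]].
(* [f] is continuous at the points of [A] as a function on the plane, so the preimage is a
   neighbourhood of each of them and may be replaced with its interior. *)
have -> : A `&` f @^-1` `]a, b[ = A `&` (f @^-1` `]a, b[)°.
  rewrite eqEsubset; split=> x [Ax fx]; split=> //; last exact: interior_subset fx.
  by apply: (cf _ Ax); exact: open_nbhs_nbhs.
by apply: measurableI => //; apply: measurable_open_plane; exact: open_interior.
Qed.

Lemma compact_cont_bounded (K : set (R * R)) f : compact K ->
  (forall q, K q -> {for q, continuous f}) ->
  exists2 M, 0 <= M & forall q, K q -> `|f q| <= M.
Proof.
move=> cK cf.
have wf : {within K, continuous f}.
  rewrite continuous_subspace_in => q /set_mem qK.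
  by apply: continuous_subspaceT_for => //; exact: cf.
have [M [_ MP]] := compact_bounded (continuous_compact wf cK).
exists (Num.max 0 (M + 1)); first by rewrite le_max lexx.
move=> q qB; rewrite le_max; apply/orP; right.
by apply: (MP (M + 1)); [rewrite ltrDl|exists q].
Qed.

Lemma integrable_rect (a b c e : R) f :
  (forall q, (`[a, b] `*` `[c, e]) q -> {for q, continuous f}) ->
  mu2.-integrable (`[a, b] `*` `[c, e]) (EFin \o f).
Proof.
move=> cf; have mK : measurable (`[a, b]%classic `*` `[c, e]%classic).
  by apply: measurableX; exact: measurable_itv.
apply: measurable_bounded_integrable => //.
- apply: le_lt_trans (_ : (mu `[a, b]%classic * mu `[c, e]%classic < +oo)%E).
    rewrite le_eqVlt; apply/orP; left; apply/eqP.
    by apply: product_measure1E; exact: measurable_itv.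
  rewrite !lebesgue_measure_itv/= !lte_fin.
  by do 2 case: ifP => _; rewrite ?mule0 ?mul0e -?EFinB -?EFinM ltry.
- exact: measurable_fun_cont.
- have [M _ MP] := compact_cont_bounded (compact_setX (@segment_compact _ a b) (@segment_compact _ c e)) cf.
  exists M; split; first exact: num_real.
  by move=> x Mx q qB /=; rewrite (le_trans (MP _ qB))// ltW.
Qed.

Lemma integrable_box p d f :
  (forall q, box p d q -> {for q, continuous f}) ->
  mu2.-integrable (box p d) (EFin \o f).
Proof. exact: integrable_rect. Qed.

Lemma fubini_rect (I J : set R) f : measurable I -> measurable J ->
  mu2.-integrable (I `*` J) (EFin \o f) ->
  (\int[mu2]_(q in I `*` J) (f q)%:E = \int[mu]_(y in J) \int[mu]_(x in I) (f (x, y))%:E)%E /\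
  (\int[mu2]_(q in I `*` J) (f q)%:E = \int[mu]_(x in I) \int[mu]_(y in J) (f (x, y))%:E)%E.
Proof.
move=> mI mJ fi.
have mIJ : measurable (I `*` J) by exact: measurableX.
have fi' : mu2.-integrable setT ((EFin \o f) \_ (I `*` J)).
  exact: (proj1 (@integrable_mkcond _ _ _ mu2 _ (EFin \o f) mIJ) fi).
split.
- rewrite integral_mkcond -(integral21_prod_meas1 fi') [RHS]integral_mkcond.
  apply: eq_integral => y _; rewrite /fubini_G patchE.
  case: ifPn => [yJ|yJ].
    rewrite [RHS]integral_mkcond; apply: eq_integral => x _.
    rewrite !patchE; congr (if _ then _ else _).
    by rewrite in_setX/= yJ andbT.
  apply: integral0_eq => x _.
  by rewrite patchE in_setX/= (negbTE yJ) andbF.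
- rewrite integral_mkcond -(integral12_prod_meas1 fi') [RHS]integral_mkcond.
  apply: eq_integral => x _; rewrite /fubini_F patchE.
  case: ifPn => [xI|xI].
    rewrite [RHS]integral_mkcond; apply: eq_integral => y _.
    rewrite !patchE; congr (if _ then _ else _).
    by rewrite in_setX/= xI.
  apply: integral0_eq => y _.
  by rewrite patchE in_setX/= (negbTE xI).
Qed.

Lemma affine_is_derive (x c s : R) :
  is_derive s (1 : R) (fun s => x + c * s) c.
Proof.
have := is_deriveD (is_derive_cst x s (1 : R)) (is_deriveZ c (is_derive_id s (1 : R))).
by rewrite add0r /GRing.scale/= mulr1.
Qed.

Lemma affine_substitution (x c : R) (G : R -> R) : 0 < c ->
  (forall s, s \in `[x - c, x + c] -> {for s, continuous G}) ->
  (\int[mu]_(t in `[(x - c)%R, (x + c)%R]) (G t)%:E =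
   \int[mu]_(s in `[(-1)%R, 1%R]) (G (x + c * s) * c)%R%:E)%E.
Proof.
move=> c0 cG.
have dF (s : R) : derivable (fun s : R => x + c * s : R) s 1 by have [] := @affine_is_derive x c s.
have cF (s : R) : {for s, continuous (fun s : R => x + c * s : R)}.
  by apply: differentiable_continuous; apply/derivable1_diffP.
have F' : derive1 (fun s : R => x + c * s : R) = cst c.
  by apply/funext => s; rewrite derive1E; have [_ ->] := @affine_is_derive x c s.
rewrite -{1}[x - c]/(x + - c) -(mulrN1 c) -{2}(mulr1 c).
rewrite (@integration_by_substitution_increasing _ (fun s => x + c * s) G (-1) 1)//=.
- by apply: eq_integral => s _; rewrite F'.
- by move=> s t _ _ st; rewrite ltrD2l ltr_pM2l.
- by rewrite F' => s _; exact: cst_continuous.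
- by rewrite F'; exact: is_cvg_cst.
- by rewrite F'; exact: is_cvg_cst.
- split=> //.
  + by apply: cvg_at_right_filter; exact: cF.
  + by apply: cvg_at_left_filter; exact: cF.
- rewrite mulrN1 mulr1 continuous_subspace_in => s /set_mem sI.
  by apply: continuous_subspaceT_for => //; exact: cG.
Qed.

Lemma continuous_pair_comp (T : topologicalType) (g1 g2 : T -> R) G (s : T) :
  {for s, continuous g1} -> {for s, continuous g2} ->
  {for (g1 s, g2 s), continuous G} -> {for s, continuous (fun t : T => G (g1 t, g2 t) : R)}.
Proof.
by move=> c1 c2 cG; exact: (cvg_comp _ G (cvg_pair c1 c2)).
Qed.

Lemma continuous_affine (T : topologicalType) (g : T -> R) (x c : R) (s : T) :
  {for s, continuous g} -> {for s, continuous (fun t : T => x + c * g t : R)}.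
Proof.
move=> cg; apply: continuousD; first exact: cst_continuous.
by apply: continuousM => //; exact: cst_continuous.
Qed.

Lemma affine_itv (x c s : R) : 0 <= c -> s \in `[-1, 1] ->
  x + c * s \in `[x - c, x + c].
Proof. by rewrite !in_itv/= => c0 /andP[s1 s2]; apply/andP; split; nra. Qed.

Lemma scale_fst (x c a b : R) F : 0 < c ->
  (forall q, (`[x - c, x + c] `*` `[a, b]) q -> {for q, continuous F}) ->
  (\int[mu2]_(q in `[(x - c)%R, (x + c)%R] `*` `[a, b]) (F q)%:E =
   \int[mu2]_(q in `[(-1)%R, 1%R] `*` `[a, b]) (F (x + c * q.1, q.2) * c)%R%:E)%E.
Proof.
move=> c0 cF.
have mI (u v : R) : measurable `[u, v]%classic by exact: measurable_itv.
have [-> _] := fubini_rect (mI _ _) (mI _ _) (integrable_rect cF).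
have cF' q : (`[-1, 1] `*` `[a, b]) q ->
    {for q, continuous (fun q => F (x + c * q.1, q.2) * c)}.
  move=> [q1 q2]; apply: continuousM; last exact: cst_continuous.
  apply: continuous_pair_comp.
  - by apply: continuous_affine; exact: cvg_fst.
  - exact: cvg_snd.
  - by apply: cF; split => //; exact: affine_itv (ltW c0) _.
have [-> _] := fubini_rect (mI _ _) (mI _ _) (integrable_rect cF').
apply: eq_integral => y /set_mem yab.
rewrite (affine_substitution (G := fun s => F (s, y)) c0)// => s sI.
apply: (@continuous_pair_comp _ id (cst y)).
- exact: cvg_id.
- exact: cst_continuous.
- exact: cF.
Qed.

Lemma scale_snd (x c a b : R) F : 0 < c ->
  (forall q, (`[a, b] `*` `[x - c, x + c]) q -> {for q, continuous F}) ->
  (\int[mu2]_(q in `[a, b] `*` `[(x - c)%R, (x + c)%R]) (F q)%:E =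
   \int[mu2]_(q in `[a, b] `*` `[(-1)%R, 1%R]) (F (q.1, x + c * q.2) * c)%R%:E)%E.
Proof.
move=> c0 cF.
have mI (u v : R) : measurable `[u, v]%classic by exact: measurable_itv.
have [_ ->] := fubini_rect (mI _ _) (mI _ _) (integrable_rect cF).
have cF' q : (`[a, b] `*` `[-1, 1]) q ->
    {for q, continuous (fun q => F (q.1, x + c * q.2) * c)}.
  move=> [q1 q2]; apply: continuousM; last exact: cst_continuous.
  apply: continuous_pair_comp.
  - exact: cvg_fst.
  - by apply: continuous_affine; exact: cvg_snd.
  - by apply: cF; split => //; exact: affine_itv (ltW c0) _.
have [_ ->] := fubini_rect (mI _ _) (mI _ _) (integrable_rect cF').
apply: eq_integral => y /set_mem yab.
rewrite (affine_substitution (G := fun s => F (y, s)) c0)// => s sI.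
apply: (@continuous_pair_comp _ (cst y) id).
- exact: cst_continuous.
- exact: cvg_id.
- exact: cF.
Qed.

Definition dil p (c : R) (y : R * R) : R * R := (p.1 + c * y.1, p.2 + c * y.2).

Notation Q := (box (0, 0) (1 : R)).

Lemma unit_boxE : Q = `[-1, 1] `*` `[-1, 1].
Proof. by rewrite /box/= !sub0r !add0r. Qed.

Lemma dil_box p c y : 0 <= c -> Q y -> box p c (dil p c y).
Proof.
move=> c0 /boxP/=; rewrite !subr0 => -[y1 y2]; apply/boxP; rewrite /dil/=.
by rewrite ![_ + c * _]addrC !addrK !normrM (ger0_norm c0); split; exact: ler_piMr.
Qed.

Lemma continuous_dil_comp p c y F : {for dil p c y, continuous F} ->
  {for y, continuous (fun z => F (dil p c z))}.
Proof.
move=> cF; apply: (@continuous_pair_comp _ (fun z => p.1 + c * z.1)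
  (fun z => p.2 + c * z.2)) => //; apply: continuous_affine.
- exact: cvg_fst.
- exact: cvg_snd.
Qed.

Lemma box_scaling p c F : 0 < c ->
  (forall q, box p c q -> {for q, continuous F}) ->
  \int[mu2]_(q in box p c) F q = c ^+ 2 * \int[mu2]_(y in Q) F (dil p c y).
Proof.
move=> c0 cF.
have cF1 q : (`[-1, 1] `*` `[p.2 - c, p.2 + c]) q ->
    {for q, continuous (fun q => F (p.1 + c * q.1, q.2) * c)}.
  move=> [q1 q2]; apply: continuousM; last exact: cst_continuous.
  apply: continuous_pair_comp.
  - by apply: continuous_affine; exact: cvg_fst.
  - exact: cvg_snd.
  - by apply: cF; split => //; exact: affine_itv (ltW c0) _.
have cF2 q : Q q -> {for q, continuous (fun q => F (dil p c q))}.
  by move=> Qq; apply: continuous_dil_comp; apply: cF; apply: dil_box => //; exact: ltW.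
rewrite -RintegralZl; [|exact: measurable_box|exact: integrable_box].
congr fine; rewrite unit_boxE /box scale_fst// scale_snd//=.
by apply: eq_integral => q _; congr EFin; rewrite /dil; ring.
Qed.

(** Fubini and the fundamental theorem of calculus on each horizontal line. With its twin in the
    other variable this is the only integration by parts of the development; the weights are chosen
    to vanish on the sides. *)
Lemma int_d1_box H (h : R * R -> R) :
  (forall q, Q q -> is_derive q.1 (1 : R) (fun s => H (s, q.2)) (h q)) ->
  (forall q, Q q -> {for q, continuous h}) ->
  (forall y, H (-1, y) = 0) -> (forall y, H (1, y) = 0) ->
  \int[mu2]_(q in Q) h q = 0.
Proof.
rewrite unit_boxE => dH ch H0 H1.
have mI (u v : R) : measurable `[u, v]%classic by exact: measurable_itv.
rewrite /Rintegral.
have [-> _] := fubini_rect (mI _ _) (mI _ _) (integrable_rect ch).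
rewrite integral0_eq// => y yI.
rewrite (@continuous_FTC2 _ _ (fun s => H (s, y)))//.
- by rewrite H0 H1 subee.
- rewrite continuous_subspace_in => s /set_mem sI.
  apply: continuous_subspaceT_for => //; apply: (@continuous_pair_comp _ id (cst y)).
  + exact: cvg_id.
  + exact: cst_continuous.
  + exact: ch.
- have cH s : s \in `[-1, 1] -> {for s, continuous (fun s => H (s, y) : R)}.
    move=> sI; apply: differentiable_continuous; apply/derivable1_diffP.
    by have [] := dH (s, y) (conj sI yI).
  split.
  + move=> s sI; have [] := dH (s, y) (conj (subset_itv_oo_cc sI) yI); done.
  + by apply: cvg_at_right_filter; apply: cH; rewrite in_itv/=; apply/andP; split; lra.
  + by apply: cvg_at_left_filter; apply: cH; rewrite in_itv/=; apply/andP; split; lra.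
- move=> s sI; rewrite derive1E.
  by have [] := dH (s, y) (conj (subset_itv_oo_cc sI) yI).
Qed.

Lemma int_d2_box H (h : R * R -> R) :
  (forall q, Q q -> is_derive q.2 (1 : R) (fun s => H (q.1, s)) (h q)) ->
  (forall q, Q q -> {for q, continuous h}) ->
  (forall y, H (y, -1) = 0) -> (forall y, H (y, 1) = 0) ->
  \int[mu2]_(q in Q) h q = 0.
Proof.
rewrite unit_boxE => dH ch H0 H1.
have mI (u v : R) : measurable `[u, v]%classic by exact: measurable_itv.
rewrite /Rintegral.
have [_ ->] := fubini_rect (mI _ _) (mI _ _) (integrable_rect ch).
rewrite integral0_eq// => y yI.
rewrite (@continuous_FTC2 _ _ (fun s => H (y, s)))//.
- by rewrite H0 H1 subee.
- rewrite continuous_subspace_in => s /set_mem sI.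
  apply: continuous_subspaceT_for => //; apply: (@continuous_pair_comp _ (cst y) id).
  + exact: cst_continuous.
  + exact: cvg_id.
  + exact: ch.
- have cH s : s \in `[-1, 1] -> {for s, continuous (fun s => H (y, s) : R)}.
    move=> sI; apply: differentiable_continuous; apply/derivable1_diffP.
    by have [] := dH (y, s) (conj yI sI).
  split.
  + move=> s sI; have [] := dH (y, s) (conj yI (subset_itv_oo_cc sI)); done.
  + by apply: cvg_at_right_filter; apply: cH; rewrite in_itv/=; apply/andP; split; lra.
  + by apply: cvg_at_left_filter; apply: cH; rewrite in_itv/=; apply/andP; split; lra.
- move=> s sI; rewrite derive1E.
  by have [] := dH (y, s) (conj yI (subset_itv_oo_cc sI)).
Qed.

End PlaneIntegral.

(** * Mean value formulas *)

Section Calculus.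
Variable R : realType.
Implicit Types (p q x y z : R * R) (d : R) (f F H : R * R -> R).

Lemma near0_norm_le (e : R) : 0 < e -> \forall h \near (0 : R), `|h| <= e.
Proof.
by move=> e0; have /cvgr0Pnorm_le := @cvg_id _ (nbhs (0 : R)); exact.
Qed.

Lemma is_derive_eps (F : R -> R) (t L : R) :
  (forall e, 0 < e -> \forall h \near 0, `|F (t + h) - F t - L * h| <= e * `|h|) ->
  is_derive t (1 : R) F L.
Proof.
move=> FL.
have cF : h^-1 *: (F (h *: (1 : R) + t) - F t) @[h --> 0^'] --> L.
  apply/cvgrPdist_le => e e0.
  have FLe := FL _ e0.
  near=> h.
  have h0 : h != 0 by near: h; exact: nbhs_dnbhs_neq.
  have -> : L - h^-1 *: (F (h *: (1 : R) + t) - F t) =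
      - (h^-1 * (F (t + h) - F t - L * h)).
    by rewrite /GRing.scale/= mulr1 [h + t]addrC; field.
  rewrite normrN normrM normfV mulrC ler_pdivrMr ?normr_gt0//.
  by near: h; exact: cvg_within FLe.
apply: DeriveDef; first by apply/cvg_ex; exists L.
exact: cvg_lim cF.
Unshelve. all: by end_near. Qed.

Lemma mvt_bound (g dg : R -> R) (a b L e : R) :
  (forall s, `|s - a| <= `|b - a| -> is_derive s (1 : R) g (dg s) /\ `|dg s - L| <= e) ->
  `|g b - g a - L * (b - a)| <= e * `|b - a|.
Proof.
move=> dgP.
have key u v : u <= v -> (forall s, s \in `[u, v] -> `|s - a| <= `|b - a|) ->
    `|g v - g u - L * (v - u)| <= e * `|v - u|.
  move=> uv uvP; have [| |c /uvP/dgP[_ ce] ->] := @MVT_segment _ g dg u v uv.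
  - by move=> s /subset_itv_oo_cc/uvP/dgP[].
  - rewrite continuous_subspace_in => s /set_mem sI.
    apply: continuous_subspaceT_for => //.
    apply: differentiable_continuous; apply/derivable1_diffP.
    by have [[]] := dgP _ (uvP _ sI).
  by rewrite -mulrBl normrM ler_wpM2r.
have [ab|/ltW ba] := leP a b.
  apply: key => // s; rewrite in_itv/= => /andP[h1 h2].
  by rewrite !ger0_norm ?subr_ge0// lerD2r.
have -> : g b - g a - L * (b - a) = - (g a - g b - L * (a - b)) by ring.
rewrite normrN [`|b - a|]distrC; apply: key => // s; rewrite in_itv/= => /andP[h1 h2].
by rewrite distrC [`|b - a|]distrC !ger0_norm ?subr_ge0// lerD2l lerN2.
Qed.

Lemma C1_is_derive1 U f p : C1_on U f -> U p ->
  is_derive p.1 (1 : R) (fun t => f (t, p.2)) (partial1 f p).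
Proof. by move=> Uf /Uf[_ df _ _ _]; apply: DeriveDef; rewrite // -derive1E. Qed.

Lemma C1_is_derive2 U f p : C1_on U f -> U p ->
  is_derive p.2 (1 : R) (fun t => f (p.1, t)) (partial2 f p).
Proof. by move=> Uf /Uf[_ _ df _ _]; apply: DeriveDef; rewrite // -derive1E. Qed.

(** [C1_on] speaks of partial derivatives only. Total differentiability comes from joining the two
    points by two segments parallel to the axes and applying [mvt_bound] to each, with the partial
    derivative at the base point as slope. *)
Lemma ray_is_derive U f x z (t : R) : C1_on U f -> nbhs (dil x t z) U ->
  is_derive t (1 : R) (fun s => f (dil x s z))
    (z.1 * partial1 f (dil x t z) + z.2 * partial2 f (dil x t z)).
Proof.
move=> Uf nU; set q := dil x t z; apply: is_derive_eps => e e0.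
(* Both coordinates of the displacement [h * z] are at most [|h| * K], and
   [(|z.1| + |z.2|) / K <= 1] turns the error [e / K] per coordinate into [e]. *)
pose K := `|z.1| + `|z.2| + 1.
have K0 : 0 < K by rewrite ltr_wpDl// addr_ge0.
have eK : 0 < e / K by rewrite divr_gt0.
have [_ _ _ c1 c2] := Uf _ (nbhs_singleton nU).
have /cvgrPdist_le/(_ _ eK) n1 := c1; have /cvgrPdist_le/(_ _ eK) n2 := c2.
have {c1 c2} : nbhs q (fun y => [/\ U y, `|partial1 f y - partial1 f q| <= e / K
    & `|partial2 f y - partial2 f q| <= e / K]).
  by apply: filterS3 nU n1 n2 => y Uy y1 y2; split => //; rewrite distrC.
move=> /nbhs_boxP[d d0 dP]; near=> h.
have hK : `|h| * K <= d.
  rewrite -ler_pdivlMr//; near: h; apply: near0_norm_le; exact: divr_gt0.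
have h1 : `|h * z.1| <= d.
  rewrite (le_trans _ hK)// normrM ler_wpM2l// /K -addrA lerDl addr_ge0//.
have h2 : `|h * z.2| <= d.
  rewrite (le_trans _ hK)// normrM ler_wpM2l// /K addrAC lerDr addr_ge0//.
pose q' := (q.1 + h * z.1, q.2 + h * z.2).
have -> : dil x (t + h) z = q' by rewrite /dil/q'/q/=; congr pair; ring.
have b1 : `|f (q.1 + h * z.1, q.2 + h * z.2) - f (q.1, q.2 + h * z.2) -
    partial1 f q * (q.1 + h * z.1 - q.1)| <= e / K * `|q.1 + h * z.1 - q.1|.
  apply: (@mvt_bound (fun s => f (s, q.2 + h * z.2)) (fun s => partial1 f (s, q.2 + h * z.2))).
  move=> s; rewrite [q.1 + _]addrC addrK => sh.
  have /dP[Us s1 _] : box q d (s, q.2 + h * z.2).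
    by apply/boxP; rewrite /= [q.2 + _]addrC addrK; split => //; exact: le_trans h1.
  by split => //; exact: (C1_is_derive1 (p := (s, q.2 + h * z.2)) Uf).
have b2 : `|f (q.1, q.2 + h * z.2) - f (q.1, q.2) -
    partial2 f q * (q.2 + h * z.2 - q.2)| <= e / K * `|q.2 + h * z.2 - q.2|.
  apply: (@mvt_bound (fun s => f (q.1, s)) (fun s => partial2 f (q.1, s))).
  move=> s; rewrite [q.2 + _]addrC addrK => sh.
  have /dP[Us _ s2] : box q d (q.1, s).
    by apply/boxP; rewrite /= subrr normr0 ltW//; split => //; exact: le_trans h2.
  by split => //; exact: (C1_is_derive2 (p := (q.1, s)) Uf).
move: b1 b2; rewrite ![_ + h * _]addrC !addrK !normrM => b1 b2.
have -> : f q' - f q - (z.1 * partial1 f q + z.2 * partial2 f q) * h =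
  (f (h * z.1 + q.1, h * z.2 + q.2) - f (q.1, h * z.2 + q.2) - partial1 f q * (h * z.1))
  + (f (q.1, h * z.2 + q.2) - f (q.1, q.2) - partial2 f q * (h * z.2)).
  rewrite /q' ![_ + h * _]addrC -(surjective_pairing q); ring.
apply: le_trans (ler_normD _ _) _; apply: le_trans (lerD b1 b2) _.
have -> : e / K * (`|h| * `|z.1|) + e / K * (`|h| * `|z.2|) =
  e * `|h| * ((`|z.1| + `|z.2|) / K) by field; rewrite gt_eqF.
apply: ler_piMr; first by rewrite mulr_ge0// ltW.
by rewrite ler_pdivrMr// mul1r lerDl.
Unshelve. all: by end_near. Qed.

Definition pos (s : R) : R := (s + `|s|) / 2.

Lemma pos_ge0 s : 0 <= pos s.
Proof. by have := ler_norm (- s); rewrite normrN /pos; lra. Qed.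

Lemma ger0_pos s : 0 <= s -> pos s = s.
Proof. by move=> s0; rewrite /pos ger0_norm//; field. Qed.

Lemma ler0_pos s : s <= 0 -> pos s = 0.
Proof. by move=> s0; rewrite /pos ler0_norm// subrr mul0r. Qed.

Lemma continuous_pos : continuous pos.
Proof.
move=> s; apply: cvgM; last exact: cvg_cst.
by apply: cvgD; [exact: cvg_id|apply: cvg_norm; exact: cvg_id].
Qed.

(** Squaring removes the kink of the positive part: whatever the signs of [s] and [s + h], the
    first-order remainder is at most [h ^+ 2]. *)
Lemma is_derive_pos2 (s : R) : is_derive s (1 : R) (fun s => pos s ^+ 2) (2 * pos s).
Proof.
apply: is_derive_eps => e e0; near=> h.
have he : `|h| <= e by near: h; exact: near0_norm_le.
apply: (@le_trans _ _ (`|h| * `|h|)); last by rewrite ler_wpM2r.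
rewrite -normrM -expr2 ger0_norm ?sqr_ge0// ler_norml.
have [s0|s0] := leP 0 s; have [sh|sh] := leP 0 (s + h);
  rewrite ?(ger0_pos s0) ?(ger0_pos sh) ?(ler0_pos (ltW s0)) ?(ler0_pos (ltW sh));
  apply/andP; split; nra.
Unshelve. all: by end_near. Qed.

(** In each of the four sign cases the remainder is at most [h ^+ 2 * (3 * pos s + |h|)]; when the
    sign changes, [s] itself is at most [|h|] in absolute value. *)
Lemma is_derive_pos3 (s : R) : is_derive s (1 : R) (fun s => pos s ^+ 3) (3 * pos s ^+ 2).
Proof.
apply: is_derive_eps => e e0; near=> h.
have he : `|h| <= e / (3 * pos s + 1).
  by near: h; apply: near0_norm_le; rewrite divr_gt0// ltr_wpDl// mulr_ge0// pos_ge0.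
have h1 : `|h| <= 1 by near: h; exact: near0_norm_le.
have p0 := pos_ge0 s; have K0 : 0 < 3 * pos s + 1 by lra.
move: he; rewrite ler_pdivlMr// => he.
apply: (@le_trans _ _ (`|h| * (3 * pos s + 1) * `|h|)); last by rewrite ler_wpM2r.
have [a0 a1 a2] : [/\ 0 <= `|h|, h <= `|h| & - h <= `|h|].
  by rewrite normr_ge0 ler_norm -normrN ler_norm.
have a3 : h ^+ 2 = `|h| ^+ 2 by rewrite real_normK ?num_real.
apply: (@le_trans _ _ (`|h| ^+ 2 * (3 * pos s + `|h|))); last first.
  by rewrite expr2 mulrAC ler_wpM2r// ler_wpM2l// lerD2l.
move: `|h| a0 a1 a2 a3 {h1 he} => a a0 a1 a2 a3; rewrite ler_norml.
have [s0|s0] := leP 0 s; have [sh|sh] := leP 0 (s + h).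
- rewrite (ger0_pos s0) (ger0_pos sh) -a3.
  have -> : (s + h) ^+ 3 - s ^+ 3 - 3 * s ^+ 2 * h = h ^+ 2 * (3 * s + h) by ring.
  by have := sqr_ge0 h; move=> h0; apply/andP; split; nra.
- rewrite (ger0_pos s0) (ler0_pos (ltW sh)).
  have s1 : s <= a by lra.
  have -> : 0 ^+ 3 - s ^+ 3 - 3 * s ^+ 2 * h = s ^+ 2 * (- 3 * h - s) by ring.
  have : s ^+ 2 <= a ^+ 2 by rewrite lerXn2r ?nnegrE.
  have : 0 <= - 3 * h - s <= 3 * a by apply/andP; split; lra.
  move: (- 3 * h - s) => w /andP[w0 w3] _.
  have e1 : s ^+ 2 * w <= s ^+ 2 * (3 * a) by rewrite ler_wpM2l ?sqr_ge0.
  have e2 : 0 <= s * a * (a - s) by rewrite !mulr_ge0// subr_ge0.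
  have e3 : 0 <= s ^+ 2 * w by rewrite mulr_ge0// sqr_ge0.
  have e4 : 0 <= a ^+ 3 by rewrite exprn_ge0.
  have e5 : 0 <= a ^+ 2 * s by rewrite mulr_ge0// sqr_ge0.
  by apply/andP; split; nra.
- rewrite (ler0_pos (ltW s0)) (ger0_pos sh).
  have e1 : (s + h) ^+ 3 <= a ^+ 3 by rewrite lerXn2r ?nnegrE//; lra.
  have e2 : 0 <= (s + h) ^+ 3 by rewrite exprn_ge0.
  by apply/andP; split; nra.
- rewrite (ler0_pos (ltW s0)) (ler0_pos (ltW sh)).
  have e4 : 0 <= a ^+ 3 by rewrite exprn_ge0.
  by apply/andP; split; nra.
Unshelve. all: by end_near. Qed.

Notation mu := (@lebesgue_measure R).
Notation mu2 := (mu \x mu)%E.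
Notation Q := (box (0, 0) (1 : R)).

(* The gradient of [phi ^+ 3] is [- 6 * eta y * y], which is what turns radial derivatives
   averaged against [eta] into Laplacians averaged against [phi ^+ 3]. *)
Definition phi (y : R * R) : R := pos (1 - y.1 ^+ 2 - y.2 ^+ 2).
Definition eta y := phi y ^+ 2.

Lemma is_derive_radius (c s : R) : is_derive s (1 : R) (fun s : R => c - s ^+ 2) (- 2 * s).
Proof.
apply: (is_derive_eq (is_deriveB (is_derive_cst c s (1 : R)) (is_deriveX 2 (is_derive_id s (1 : R))))).
by rewrite /GRing.scale/=; ring.
Qed.

Lemma eta_derive1 q : is_derive q.1 (1 : R) (fun s => eta (s, q.2)) (- 4 * q.1 * phi q).
Proof.
have h := is_derive_radius (1 - q.2 ^+ 2) q.1.
have := is_derive1_comp (is_derive_pos2 _) h.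
have -> : 2 * pos (1 - q.2 ^+ 2 - q.1 ^+ 2) * (-2 * q.1) = - 4 * q.1 * phi q.
  by rewrite /phi addrAC; ring.
by congr is_derive; apply/funext => s; rewrite /eta /phi/= addrAC.
Qed.

Lemma eta_derive2 q : is_derive q.2 (1 : R) (fun s => eta (q.1, s)) (- 4 * q.2 * phi q).
Proof.
have h := is_derive_radius (1 - q.1 ^+ 2) q.2.
have := is_derive1_comp (is_derive_pos2 _) h.
have -> : 2 * pos (1 - q.1 ^+ 2 - q.2 ^+ 2) * (-2 * q.2) = - 4 * q.2 * phi q.
  by rewrite /phi; ring.
by congr is_derive; apply/funext => s; rewrite /eta /phi/=.
Qed.

Lemma phi3_derive1 q : is_derive q.1 (1 : R) (fun s => phi (s, q.2) ^+ 3) (- 6 * q.1 * eta q).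
Proof.
have h := is_derive_radius (1 - q.2 ^+ 2) q.1.
have := is_derive1_comp (is_derive_pos3 _) h.
have -> : 3 * pos (1 - q.2 ^+ 2 - q.1 ^+ 2) ^+ 2 * (-2 * q.1) = - 6 * q.1 * eta q.
  by rewrite /eta /phi addrAC; ring.
by congr is_derive; apply/funext => s; rewrite /phi/= addrAC.
Qed.

Lemma phi3_derive2 q : is_derive q.2 (1 : R) (fun s => phi (q.1, s) ^+ 3) (- 6 * q.2 * eta q).
Proof.
have h := is_derive_radius (1 - q.1 ^+ 2) q.2.
have := is_derive1_comp (is_derive_pos3 _) h.
have -> : 3 * pos (1 - q.1 ^+ 2 - q.2 ^+ 2) ^+ 2 * (-2 * q.2) = - 6 * q.2 * eta q.
  by rewrite /eta /phi; ring.
by congr is_derive; apply/funext => s; rewrite /phi/=.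
Qed.

Lemma phi_bound y : 0 <= phi y <= 1.
Proof.
rewrite pos_ge0/= /phi; have := sqr_ge0 y.1; have := sqr_ge0 y.2.
move: (y.1 ^+ 2) (y.2 ^+ 2) => a b a0 b0.
have [h|/ltW h] := leP 0 (1 - a - b); first by rewrite ger0_pos//; lra.
by rewrite ler0_pos// ler01.
Qed.

Lemma eta_bound y : 0 <= eta y <= 1.
Proof.
have /andP[h0 h1] := phi_bound y.
by rewrite sqr_ge0/= expr_le1.
Qed.

Lemma phi_side1 (y : R) : phi (1, y) = 0 /\ phi (-1, y) = 0.
Proof.
by rewrite /phi/= sqrrN expr1n subrr sub0r; split; apply: ler0_pos; rewrite oppr_le0 sqr_ge0.
Qed.

Lemma phi_side2 (y : R) : phi (y, 1) = 0 /\ phi (y, -1) = 0.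
Proof.
rewrite /phi/= sqrrN expr1n addrAC subrr sub0r; split; apply: ler0_pos; by rewrite oppr_le0 sqr_ge0.
Qed.

Lemma continuous_phi q : {for q, continuous phi}.
Proof.
apply: (@continuous_comp _ _ _ (fun y : R * R => 1 - y.1 ^+ 2 - y.2 ^+ 2) pos); last exact: continuous_pos.
apply: continuousB; last first.
  by apply: (@continuous_comp _ _ _ snd (fun s : R => s ^+ 2)); [exact: cvg_snd|exact: exprn_continuous].
apply: continuousB; first exact: cst_continuous.
by apply: (@continuous_comp _ _ _ fst (fun s : R => s ^+ 2)); [exact: cvg_fst|exact: exprn_continuous].
Qed.

Lemma continuous_eta q : {for q, continuous eta}.
Proof. by apply: (@continuous_comp _ _ _ phi (fun s : R => s ^+ 2)); [exact: continuous_phi|exact: exprn_continuous]. Qed.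

Lemma dil_box_norm p (c d : R) y : `|c| <= d -> Q y -> box p d (dil p c y).
Proof.
move=> cd /boxP/=; rewrite !subr0 => -[y1 y2]; apply/boxP; rewrite /dil/=.
rewrite ![_ + c * _]addrC !addrK !normrM.
by split; apply: le_trans cd; exact: ler_piMr.
Qed.

Definition mass : R := \int[mu2]_(y in Q) eta y.

Lemma le_Rintegral_subset (A B : set (R * R)) f : measurable A -> measurable B ->
  A `<=` B -> mu2.-integrable B (EFin \o f) -> (forall q, B q -> 0 <= f q) ->
  \int[mu2]_(q in A) f q <= \int[mu2]_(q in B) f q.
Proof.
move=> mA mB AB fi f0; rewrite /Rintegral fine_le//.
- by apply: integrable_fin_num => //; exact: (@integrableS _ _ _ mu2 _ _ _ mB mA AB fi).
- exact: integrable_fin_num.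
- by apply: ge0_subset_integral => //; exact: measurable_int fi.
Qed.

Lemma mu2_unit_box : mu2 Q = 4%:E.
Proof.
rewrite unit_boxE product_measure1E/=; [|exact: measurable_itv|exact: measurable_itv].
rewrite !lebesgue_measure_itv/= !lte_fin.
have -> : (-1 < 1 :> R) by lra.
by rewrite -EFinB -EFinM; congr EFin; ring.
Qed.

Lemma Rintegral_unit_box_cst (c : R) : \int[mu2]_(y in Q) c = 4 * c.
Proof.
rewrite Rintegral_cst; last exact: measurable_box.
by rewrite mulrC; congr (_ * _); exact: (congr1 fine mu2_unit_box).
Qed.

Lemma normr_Rintegral_unit_box f (M : R) : (forall y, Q y -> {for y, continuous f}) ->
  (forall y, Q y -> `|f y| <= M) -> `|\int[mu2]_(y in Q) f y| <= 4 * M.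
Proof.
move=> cf fM; have fi := integrable_box cf.
rewrite -Rintegral_unit_box_cst; apply: le_trans.
  by apply: le_normr_Rintegral fi; exact: measurable_box.
apply: le_Rintegral => //; first exact: measurable_box.
- apply: integrable_box => y Qy; apply: (@continuous_comp _ _ _ f (@Num.norm _ _)); first exact: cf.
  exact: norm_continuous.
- by apply: integrable_box => y _; exact: cst_continuous.
Qed.

Lemma eta_ge y : box (0, 0) (1 / 2) y -> 1 / 4 <= eta y.
Proof.
move=> /boxP/=; rewrite !subr0 !ler_norml => -[/andP[a1 a2] /andP[b1 b2]].
have h : 1 / 2 <= 1 - y.1 ^+ 2 - y.2 ^+ 2 by nra.
rewrite /eta /phi ger0_pos; last by lra.
by move: (1 - _ - _) h => w h; nra.
Qed.

(** Crude bounds replace the exact value: [eta] is at least 1/4 on the concentric square of area 1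
    and at most 1 on the square of area 4. *)
Lemma mass_bounds : 1 / 4 <= mass <= 4.
Proof.
have ci y : Q y -> {for y, continuous eta} by move=> _; exact: continuous_eta.
have cc (c : R) p d : mu2.-integrable (box p d) (EFin \o cst c).
  by apply: integrable_box => y _; exact: cst_continuous.
apply/andP; split; last first.
  rewrite -[leRHS]mulr1 -Rintegral_unit_box_cst; apply: le_Rintegral.
  - exact: measurable_box.
  - exact: integrable_box.
  - exact: cc.
  - by move=> y _; have /andP[] := eta_bound y.
have sub : box (0, 0) (1 / 2) `<=` Q by apply: box_subr; lra.
rewrite (@le_trans _ _ (\int[mu2]_(y in box (0, 0) (1 / 2)) eta y))//; last first.
  apply: le_Rintegral_subset => //; [exact: measurable_box|exact: measurable_box| |].
  - exact: integrable_box.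
  - by move=> y _; have /andP[] := eta_bound y.
rewrite (@le_trans _ _ (\int[mu2]_(y in box (0, 0) (1 / 2)) (1 / 4)))//; last first.
  apply: le_Rintegral => //; [exact: measurable_box|exact: cc| |exact: eta_ge].
  by apply: integrable_box => y _; exact: continuous_eta.
rewrite box_scaling; [|lra|by move=> q _; exact: cst_continuous].
by rewrite Rintegral_unit_box_cst; lra.
Qed.

Lemma integrable_unit_boxZ (c : R) f : mu2.-integrable Q (EFin \o f) ->
  mu2.-integrable Q (EFin \o (fun y => c * f y)).
Proof.
move=> fi; have mQ := @measurable_box R (0, 0) 1.
rewrite (_ : _ \o _ = (fun y => c%:E * (f y)%:E)%E); last by apply/funext => y /=; rewrite EFinM.
by apply: integrableZl.
Qed.

(** * Averages against the radial weight *)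

Section MeanValue.
Variables (U : set (R * R)) (x : R * R) (rho : R).
Hypotheses (oU : open U) (rho0 : 0 < rho) (boxU : box x (2 * rho) `<=` U).

Let inU t y : `|t| <= 2 * rho -> Q y -> U (dil x t y).
Proof. by move=> tr Qy; apply: boxU; exact: dil_box_norm. Qed.

Let normt (t : R) : t \in `]0, rho[ -> `|t| <= 2 * rho.
Proof. by rewrite in_itv/= => /andP[t0 tr]; rewrite gtr0_norm//; lra. Qed.

(** Differentiation under the integral, dominated by the maxima of the partial derivatives on the
    compact square. The interval of [t] contains negative values and reaches beyond [rho], so that
    both ends of [[0, rho]] are interior to it. *)
Lemma radial_average_is_derive f t : C1_on U f -> t \in `](- (2 * rho)), (2 * rho)[ ->
  is_derive t (1 : R) (fun s => \int[mu2]_(y in Q) (eta y * f (dil x s y)))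
    (\int[mu2]_(y in Q) (eta y * (y.1 * partial1 f (dil x t y) + y.2 * partial2 f (dil x t y)))).
Proof.
move=> Uf tI.
have nI (s : R) : s \in `](- (2 * rho)), (2 * rho)[ -> `|s| <= 2 * rho.
  by rewrite in_itv/= => /andP[s1 s2]; rewrite ler_norml !ltW.
pose F s (y : R * R) := eta y * f (dil x s y).
have dF s y : s \in `](- (2 * rho)), (2 * rho)[ -> Q y -> is_derive s (1 : R) (F ^~ y)
    (eta y * (y.1 * partial1 f (dil x s y) + y.2 * partial2 f (dil x s y))).
  move=> sI Qy; apply: is_deriveZ; apply: (ray_is_derive Uf).
  by apply: open_nbhs_nbhs; split => //; apply: inU => //; exact: nI.
have [M1 M10 M1P] := compact_cont_bounded (@box_compact _ x (2 * rho))
  (fun q qB => let: And5 _ _ _ c _ := Uf _ (boxU qB) in c).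
have [M2 M20 M2P] := compact_cont_bounded (@box_compact _ x (2 * rho))
  (fun q qB => let: And5 _ _ _ _ c := Uf _ (boxU qB) in c).
have intF s : s \in `](- (2 * rho)), (2 * rho)[ -> mu2.-integrable Q (EFin \o F s).
  move=> sI; apply: integrable_box => y Qy; apply: continuousM; first exact: continuous_eta.
  by apply: continuous_dil_comp; have [] := Uf _ (inU (nI _ sI) Qy).
have bnd s y : s \in `](- (2 * rho)), (2 * rho)[ -> Q y ->
    `|partial1of2 F s y| <= M1 + M2.
  move=> sI Qy; rewrite partial1of2E; have [_ ->] := dF _ _ sI Qy.
  have /andP[e0 e1] := eta_bound y; have := Qy => /boxP/=; rewrite !subr0 => -[y1 y2].
  have qB : box x (2 * rho) (dil x s y) by apply: dil_box_norm => //; exact: nI.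
  rewrite normrM ger0_norm// (le_trans (ler_piMl _ e1))//.
  rewrite (le_trans (ler_normD _ _))// lerD// normrM.
    by rewrite (le_trans (ler_piMl _ y1))// M1P.
  by rewrite (le_trans (ler_piMl _ y2))// M2P.
have intM : mu2.-integrable Q (EFin \o cst (M1 + M2)).
  by apply: integrable_box => y _; exact: cst_continuous.
have M0 : forall y : R * R, 0 <= cst (M1 + M2) y by move=> y /=; rewrite addr_ge0.
have dF' s y : s \in `](- (2 * rho)), (2 * rho)[ -> Q y -> derivable (F ^~ y) s (1 : R).
  by move=> sI Qy; have [] := dF _ _ sI Qy.
apply: DeriveDef.
  exact: (@derivable_under_integral _ _ _ mu2 F Q (measurable_box _ _) t _ _ tI intF dF' _ M0 intM bnd).
rewrite -derive1E (@differentiation_under_integral _ _ _ mu2 F Q (measurable_box _ _) t _ _ tI intF dF' _ M0 intM bnd).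
apply: eq_Rintegral => y /set_mem Qy; rewrite partial1of2E.
by have [_ ->] := dF _ _ tI Qy.
Qed.

(** The mean value theorem in [t] yields a single intermediate radius instead of an integral over
    radii; later bounds are uniform in that radius. At [t = 0] the dilated square collapses to [x],
    which produces [mass * f x]. *)
Lemma radial_average_mvt f : C1_on U f -> exists2 t, t \in `]0, rho[ &
  \int[mu2]_(y in Q) (eta y * f (dil x rho y)) - mass * f x =
  rho * \int[mu2]_(y in Q) (eta y * (y.1 * partial1 f (dil x t y) + y.2 * partial2 f (dil x t y))).
Proof.
move=> Uf.
pose I s := \int[mu2]_(y in Q) (eta y * f (dil x s y)).
have dI (s : R) : s \in `[0, rho] -> s \in `](- (2 * rho)), (2 * rho)[.
  by have := rho0; rewrite !in_itv/= => r0 /andP[s0 s1]; apply/andP; split; lra.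
pose J t := \int[mu2]_(y in Q) (eta y * (y.1 * partial1 f (dil x t y) + y.2 * partial2 f (dil x t y))).
have [| |t tI E] := @MVT _ I J 0 rho rho0.
- by move=> s /subset_itv_oo_cc/dI sI; exact: radial_average_is_derive.
- apply: continuous_in_subspaceT => s /set_mem sI.
  apply: differentiable_continuous; apply/derivable1_diffP.
  by have [] := radial_average_is_derive Uf (dI _ sI).
exists t => //; rewrite -/(J t) [rho * _]mulrC; move: E; rewrite subr0 => <-; congr (_ - _).
rewrite /I /mass -RintegralZr; [|exact: measurable_box|].
  by apply: eq_Rintegral => y _; rewrite /dil !mul0r !addr0 -surjective_pairing.
by apply: integrable_box => y _; exact: continuous_eta.
Qed.

Lemma dil_is_derive1 f t q : C1_on U f -> U (dil x t q) ->
  is_derive q.1 (1 : R) (fun s => f (dil x t (s, q.2))) (partial1 f (dil x t q) * t).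
Proof.
move=> Uf Uq; have h := C1_is_derive1 Uf Uq.
exact: (is_derive1_comp (f := fun s => f (s, (dil x t q).2)) (g := fun s => x.1 + t * s) h (@affine_is_derive _ x.1 t q.1)).
Qed.

Lemma dil_is_derive2 f t q : C1_on U f -> U (dil x t q) ->
  is_derive q.2 (1 : R) (fun s => f (dil x t (q.1, s))) (partial2 f (dil x t q) * t).
Proof.
move=> Uf Uq; have h := C1_is_derive2 Uf Uq.
exact: (is_derive1_comp (f := fun s => f ((dil x t q).1, s)) (g := fun s => x.2 + t * s) h (@affine_is_derive _ x.2 t q.2)).
Qed.

Lemma int_d1_dil (g dg : R * R -> R) f t : C1_on U f -> `|t| <= 2 * rho ->
  (forall q, is_derive q.1 (1 : R) (fun s => g (s, q.2)) (dg q)) ->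
  (forall q, {for q, continuous g}) -> (forall q, {for q, continuous dg}) ->
  (forall y : R, g (1, y) = 0 /\ g (-1, y) = 0) ->
  \int[mu2]_(y in Q) (g y * (partial1 f (dil x t y) * t) + f (dil x t y) * dg y) = 0.
Proof.
move=> Uf tr gd cg cdg g0.
apply: (@int_d1_box _ (fun y => g y * f (dil x t y))).
- move=> [q1 q2] Qq; have h := dil_is_derive1 Uf (inU tr Qq).
  exact: (is_deriveM (gd (q1, q2)) h).
- move=> q Qq; have Uq := inU tr Qq; apply: continuousD; apply: continuousM => //.
  + apply: continuousM; last exact: cst_continuous.
    by apply: continuous_dil_comp; have [] := Uf _ Uq.
  + by apply: continuous_dil_comp; have [] := Uf _ Uq.
- by move=> y; have [_ ->] := g0 y; rewrite mul0r.
- by move=> y; have [-> _] := g0 y; rewrite mul0r.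
Qed.

Lemma int_d2_dil (g dg : R * R -> R) f t : C1_on U f -> `|t| <= 2 * rho ->
  (forall q, is_derive q.2 (1 : R) (fun s => g (q.1, s)) (dg q)) ->
  (forall q, {for q, continuous g}) -> (forall q, {for q, continuous dg}) ->
  (forall y : R, g (y, 1) = 0 /\ g (y, -1) = 0) ->
  \int[mu2]_(y in Q) (g y * (partial2 f (dil x t y) * t) + f (dil x t y) * dg y) = 0.
Proof.
move=> Uf tr gd cg cdg g0.
apply: (@int_d2_box _ (fun y => g y * f (dil x t y))).
- move=> [q1 q2] Qq; have h := dil_is_derive2 Uf (inU tr Qq).
  exact: (is_deriveM (gd (q1, q2)) h).
- move=> q Qq; have Uq := inU tr Qq; apply: continuousD; apply: continuousM => //.
  + apply: continuousM; last exact: cst_continuous.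
    by apply: continuous_dil_comp; have [] := Uf _ Uq.
  + by apply: continuous_dil_comp; have [] := Uf _ Uq.
- by move=> y; have [_ ->] := g0 y; rewrite mul0r.
- by move=> y; have [-> _] := g0 y; rewrite mul0r.
Qed.

Lemma continuous_fst_lin (c : R) q : {for q, continuous (fun y : R * R => c * y.1)}.
Proof. by apply: continuousM; [exact: cst_continuous|exact: cvg_fst]. Qed.

Lemma continuous_snd_lin (c : R) q : {for q, continuous (fun y : R * R => c * y.2)}.
Proof. by apply: continuousM; [exact: cst_continuous|exact: cvg_snd]. Qed.

Lemma continuous_addZ f F (c : R) q : {for q, continuous f} -> {for q, continuous F} ->
  {for q, continuous (fun y => f y + c * F y)}.
Proof.
by move=> cf cF; apply: continuousD => //; apply: continuousM => //; exact: cst_continuous.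
Qed.

Lemma continuous_phi3 q : {for q, continuous (fun y => phi y ^+ 3)}.
Proof.
by apply: (@continuous_comp _ _ _ phi (fun s : R => s ^+ 3)); [exact: continuous_phi|exact: exprn_continuous].
Qed.

Lemma mean_value_laplacian u : C2_on U u -> exists2 t, t \in `]0, rho[ &
  \int[mu2]_(y in Q) (eta y * u (dil x rho y)) - mass * u x =
  rho * t / 6 * \int[mu2]_(y in Q) (phi y ^+ 3 * laplacian u (dil x t y)).
Proof.
move=> [C1u C1u1 C1u2]; have [t tI ->] := radial_average_mvt C1u.
exists t => //; have tr := normt tI.
(* [h1 + h2] is the divergence in [y] of [phi ^+ 3] times the gradient of [u] at [dil x t y], a
   field that vanishes on the sides of the square. *)
pose h1 y := phi y ^+ 3 * (partial1 (partial1 u) (dil x t y) * t)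
  + partial1 u (dil x t y) * (- 6 * y.1 * eta y).
pose h2 y := phi y ^+ 3 * (partial2 (partial2 u) (dil x t y) * t)
  + partial2 u (dil x t y) * (- 6 * y.2 * eta y).
have h10 : \int[mu2]_(y in Q) h1 y = 0.
  apply: (@int_d1_dil (fun y => phi y ^+ 3) (fun y => - 6 * y.1 * eta y) (partial1 u) t C1u1 tr).
  - exact: phi3_derive1.
  - exact: continuous_phi3.
  - by move=> q; apply: continuousM; [exact: continuous_fst_lin|exact: continuous_eta].
  - by move=> y; have [-> ->] := phi_side1 y; rewrite expr0n.
have h20 : \int[mu2]_(y in Q) h2 y = 0.
  apply: (@int_d2_dil (fun y => phi y ^+ 3) (fun y => - 6 * y.2 * eta y) (partial2 u) t C1u2 tr).
  - exact: phi3_derive2.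
  - exact: continuous_phi3.
  - by move=> q; apply: continuousM; [exact: continuous_snd_lin|exact: continuous_eta].
  - by move=> y; have [-> ->] := phi_side2 y; rewrite expr0n.
have cd f q : C1_on U f -> Q q -> [/\ {for q, continuous (fun y => f (dil x t y))},
    {for q, continuous (fun y => partial1 f (dil x t y))} &
    {for q, continuous (fun y => partial2 f (dil x t y))}].
  move=> Uf Qq; have [c0 _ _ c1 c2] := Uf _ (inU tr Qq).
  by split; exact: continuous_dil_comp.
have i1 : mu2.-integrable Q (EFin \o h1).
  apply: integrable_box => q Qq; have [a1 b1 _] := cd _ _ C1u1 Qq.
  apply: continuousD; apply: continuousM => //.
  - exact: continuous_phi3.
  - by apply: continuousM => //; exact: cst_continuous.
  - by apply: continuousM; [exact: continuous_fst_lin|exact: continuous_eta].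
have i2 : mu2.-integrable Q (EFin \o h2).
  apply: integrable_box => q Qq; have [a1 _ b1] := cd _ _ C1u2 Qq.
  apply: continuousD; apply: continuousM => //.
  - exact: continuous_phi3.
  - by apply: continuousM => //; exact: cst_continuous.
  - by apply: continuousM; [exact: continuous_snd_lin|exact: continuous_eta].
have il : mu2.-integrable Q (EFin \o (fun y => phi y ^+ 3 * laplacian u (dil x t y))).
  apply: integrable_box => q Qq; apply: continuousM; first exact: continuous_phi3.
  have [_ b1 _] := cd _ _ C1u1 Qq; have [_ _ b2] := cd _ _ C1u2 Qq.
  exact: (continuousD b1 b2).
have i3 : mu2.-integrable Q (EFin \o (fun y => h1 y + h2 y)).
  by rewrite (_ : _ \o _ = (EFin \o h1) \+ (EFin \o h2))%E//; apply: integrableD => //; exact: measurable_box.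
have E y : eta y * (y.1 * partial1 u (dil x t y) + y.2 * partial2 u (dil x t y)) =
   t / 6 * (phi y ^+ 3 * laplacian u (dil x t y)) - 6^-1 * (h1 y + h2 y).
  by rewrite /h1 /h2 /laplacian; field.
under eq_Rintegral do rewrite E.
rewrite RintegralB; [|exact: measurable_box|..].
- rewrite !RintegralZl//; [|exact: measurable_box..].
  by rewrite RintegralD// ?h10 ?h20; [rewrite addr0 mulr0 subr0; ring|exact: measurable_box].
- exact: integrable_unit_boxZ.
- exact: integrable_unit_boxZ.
Qed.

(* As [eta] is radial, [y.1 * partial2 q - y.2 * partial1 q] has average zero, so only the
   defects in the Cauchy-Riemann equations contribute to the radial derivative of p. *)
Lemma mean_value_Cauchy_Riemann (p q : R * R -> R) (s k : R) : C1_on U p -> C1_on U q ->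
  (forall z, box x rho z -> `|partial1 p z - s * partial2 q z| <= k /\
     `|partial2 p z + s * partial1 q z| <= k) ->
  `|\int[mu2]_(y in Q) (eta y * p (dil x rho y)) - mass * p x| <= 8 * rho * k.
Proof.
move=> C1p C1q CR; have [t tI ->] := radial_average_mvt C1p; have tr := normt tI.
have t0 : 0 < t by move: tI; rewrite in_itv => /andP[].
(* [h1] is the first partial derivative of [y.2 * eta y * q (dil x t y)] and [h2] the second one of
   [y.1 * eta y * q (dil x t y)]. In [h2 - h1] the terms that carry a derivative of [eta] cancel,
   which leaves [t] times the angular derivative of [q] weighted by [eta]. *)
pose h1 y := (y.2 * eta y) * (partial1 q (dil x t y) * t)
  + q (dil x t y) * (y.2 * (- 4 * y.1 * phi y)).
pose h2 y := (y.1 * eta y) * (partial2 q (dil x t y) * t)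
  + q (dil x t y) * (y.1 * (- 4 * y.2 * phi y)).
have h10 : \int[mu2]_(y in Q) h1 y = 0.
  apply: (@int_d1_dil (fun y => y.2 * eta y) (fun y => y.2 * (- 4 * y.1 * phi y)) q t C1q tr).
  - by move=> z; apply: is_deriveZ; exact: eta_derive1.
  - by move=> z; apply: continuousM; [exact: cvg_snd|exact: continuous_eta].
  - move=> z; apply: continuousM; first exact: cvg_snd.
    by apply: continuousM; [exact: continuous_fst_lin|exact: continuous_phi].
  - by move=> y; rewrite /eta; have [-> ->] := phi_side1 y; rewrite expr0n mulr0.
have h20 : \int[mu2]_(y in Q) h2 y = 0.
  apply: (@int_d2_dil (fun y => y.1 * eta y) (fun y => y.1 * (- 4 * y.2 * phi y)) q t C1q tr).
  - by move=> z; apply: is_deriveZ; exact: eta_derive2.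
  - by move=> z; apply: continuousM; [exact: cvg_fst|exact: continuous_eta].
  - move=> z; apply: continuousM; first exact: cvg_fst.
    by apply: continuousM; [exact: continuous_snd_lin|exact: continuous_phi].
  - by move=> y; rewrite /eta; have [-> ->] := phi_side2 y; rewrite expr0n mulr0.
have cd f z : C1_on U f -> Q z -> [/\ {for z, continuous (fun y => f (dil x t y))},
    {for z, continuous (fun y => partial1 f (dil x t y))} &
    {for z, continuous (fun y => partial2 f (dil x t y))}].
  move=> Uf Qq; have [c0 _ _ c1 c2] := Uf _ (inU tr Qq).
  by split; exact: continuous_dil_comp.
have i1 : mu2.-integrable Q (EFin \o h1).
  apply: integrable_box => z Qz; have [a0 a1 a2] := cd _ _ C1q Qz.
  apply: continuousD; apply: continuousM => //; apply: continuousM.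
  - exact: cvg_snd.
  - exact: continuous_eta.
  - exact: a1.
  - exact: cst_continuous.
  - exact: cvg_snd.
  - by apply: continuousM; [exact: continuous_fst_lin|exact: continuous_phi].
have i2 : mu2.-integrable Q (EFin \o h2).
  apply: integrable_box => z Qz; have [a0 a1 a2] := cd _ _ C1q Qz.
  apply: continuousD; apply: continuousM => //; apply: continuousM.
  - exact: cvg_fst.
  - exact: continuous_eta.
  - exact: a2.
  - exact: cst_continuous.
  - exact: cvg_fst.
  - by apply: continuousM; [exact: continuous_snd_lin|exact: continuous_phi].
pose g y := eta y * (y.1 * (partial1 p (dil x t y) + - s * partial2 q (dil x t y))
   + y.2 * (partial2 p (dil x t y) + s * partial1 q (dil x t y))).
have cg z : Q z -> {for z, continuous g}.
  move=> Qz; have [_ p1 p2] := cd _ _ C1p Qz; have [_ q1 q2] := cd _ _ C1q Qz.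
  apply: continuousM; first exact: continuous_eta.
  apply: continuousD; apply: continuousM.
  - exact: cvg_fst.
  - exact: (continuous_addZ p1 q2).
  - exact: cvg_snd.
  - exact: (continuous_addZ p2 q1).
have E y : eta y * (y.1 * partial1 p (dil x t y) + y.2 * partial2 p (dil x t y)) =
   g y + (s / t) * (h2 y - h1 y).
  by rewrite /h1 /h2 /g; field; rewrite gt_eqF.
have i3 : mu2.-integrable Q (EFin \o (fun y => h2 y - h1 y)).
  by rewrite (_ : _ \o _ = (EFin \o h2) \- (EFin \o h1))%E//; apply: integrableB => //; exact: measurable_box.
under eq_Rintegral do rewrite E.
rewrite RintegralD; [|exact: measurable_box|exact: integrable_box|]; last first.
  exact: integrable_unit_boxZ.
rewrite RintegralZl//; [|exact: measurable_box].
rewrite RintegralB//; [|exact: measurable_box].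
rewrite h10 h20 subr0 mulr0 addr0 normrM (gtr0_norm rho0).
(* Area 4 of the unit square, times two defects of size [k] each. *)
have -> : 8 * rho * k = rho * (4 * (k + k)) by ring.
rewrite ler_wpM2l ?(ltW rho0)//; apply: (normr_Rintegral_unit_box cg) => z Qz.
have tle : t <= rho by move: tI; rewrite in_itv/= => /andP[_ /ltW].
have [k1 k2] : `|partial1 p (dil x t z) - s * partial2 q (dil x t z)| <= k /\
     `|partial2 p (dil x t z) + s * partial1 q (dil x t z)| <= k.
  by apply: CR; apply: dil_box_norm => //; rewrite gtr0_norm.
have /andP[e0 e1] := eta_bound z; have := Qz => /boxP/=; rewrite !subr0 => -[y1 y2].
rewrite normrM (ger0_norm e0) (le_trans (ler_piMl _ e1))//.
rewrite (le_trans (ler_normD _ _))// lerD// normrM.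
  by rewrite mulNr (le_trans (ler_piMl _ y1)).
by rewrite (le_trans (ler_piMl _ y2)).
Qed.

End MeanValue.

End Calculus.

(** * Local estimates *)

Section LocalEstimates.
Variable R : realType.
Implicit Types (p q x y z : R * R) (d : R) (f F H u : R * R -> R) (U : set (R * R)).
Notation mu := (@lebesgue_measure R).
Notation mu2 := (mu \x mu)%E.
Notation Q := (box (0, 0) (1 : R)).
Notation mass := (@mass R).

Lemma box_normP p d q : box p d q <-> `|q - p| <= d.
Proof.
rewrite boxP prod_normE/= ge_max; split=> [[-> ->]//|/andP[]//].
Qed.

(* [x0] maximises [(d - `|x - p|) ^+ 2 * S x], and [s] is half its distance to the boundary. *)
Lemma point_picking p d (S : R * R -> R) : 0 < d ->
  (forall q, box p d q -> {for q, continuous S}) -> (forall q, 0 <= S q) ->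
  exists x0 s, [/\ 0 <= s <= d / 2, box x0 s `<=` box p d,
    forall x, box x0 s x -> S x <= 4 * S x0 &
    forall x, box p (d / 2) x -> d ^+ 2 * S x <= 16 * (s ^+ 2 * S x0)].
Proof.
move=> d0 cS S0.
pose G x := (d - `|x - p|) ^+ 2 * S x.
have cG : {within box p d, continuous G}.
  rewrite continuous_subspace_in => q /set_mem qB.
  apply: continuous_subspaceT_for => //; apply: continuousM; last exact: cS.
  apply: (@continuous_comp _ _ _ (fun x => d - `|x - p|) (fun s : R => s ^+ 2)); last exact: exprn_continuous.
  apply: continuousB; first exact: cst_continuous.
  apply: (@continuous_comp _ _ _ (fun x => x - p) (@Num.norm _ _)); last exact: norm_continuous.
  by apply: continuousB; [exact: cvg_id|exact: cst_continuous].
have [x0 /set_mem x0B x0P] := compact_EVT_max (ex_intro _ p (box_center p (ltW d0)))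
  (@box_compact _ p d) cG.
have {}x0P x : box p d x -> G x <= G x0 by move=> xB; apply: x0P; exact/mem_set.
have x0d : `|x0 - p| <= d by exact/box_normP.
exists x0, ((d - `|x0 - p|) / 2).
set s := (d - _) / 2.
have s0 : 0 <= s by rewrite divr_ge0// subr_ge0.
have sE : d - `|x0 - p| = 2 * s by rewrite /s; field.
have sub : box x0 s `<=` box p d.
  move=> x /box_normP xs; apply/box_normP.
  by have := ler_distD x0 x p; lra.
split => //.
- by rewrite s0/= /s; have := normr_ge0 (x0 - p); lra.
(* The distance to the boundary is [2 * s] at [x0] and at least [s] on the small square; the squared
   ratio is 4. *)
- move=> x xs; have := x0P _ (sub _ xs); rewrite /G sE.
  have xp : s <= d - `|x - p|.
    by move/box_normP: xs => xs; have := ler_distD x0 x p; lra.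
  have [s_eq0|s_neq0] := eqVneq s 0.
    move: xs; rewrite s_eq0 => /box_normP; rewrite normr_le0 subr_eq0 => /eqP -> _.
    by have := S0 x0; lra.
  move=> h; rewrite -(ler_pM2l (exprn_gt0 2 (_ : 0 < s))); last by rewrite lt_neqAle eq_sym s_neq0.
  have : s ^+ 2 * S x <= (d - `|x - p|) ^+ 2 * S x.
    by rewrite ler_wpM2r// lerXn2r// nnegrE// (le_trans s0).
  move: (S x) (S x0) h => a b; rewrite exprMn; lra.
(* On the half square the distance to the boundary is at least [d / 2], so [(d / 2) ^+ 2 * S x <= (2
   * s) ^+ 2 * S x0], whence the 16. *)
- move=> x xd; have xd' : box p d x by apply: box_subr xd; lra.
  have := x0P _ xd'; rewrite /G sE.
  have xp : d / 2 <= d - `|x - p| by move/box_normP: xd => xd; lra.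
  have : (d / 2) ^+ 2 * S x <= (d - `|x - p|) ^+ 2 * S x.
    by rewrite ler_wpM2r// lerXn2r// nnegrE; lra.
  move: (S x) (S x0) => a b; rewrite !exprMn; lra.
Qed.

Lemma Rintegral_dil x (rho : R) F : 0 < rho ->
  (forall q, box x rho q -> {for q, continuous F}) ->
  \int[mu2]_(y in Q) F (dil x rho y) = rho ^- 2 * \int[mu2]_(q in box x rho) F q.
Proof. by move=> r0 cF; rewrite (box_scaling r0 cF) mulKf// expf_neq0// gt_eqF. Qed.

Lemma phi3_bound y : 0 <= phi y ^+ 3 <= 1.
Proof.
have /andP[h0 h1] := phi_bound y.
by rewrite exprn_ge0//= exprn_ile1.
Qed.

Lemma continuous_laplacian U u q : C2_on U u -> U q -> {for q, continuous (laplacian u)}.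
Proof.
move=> [_ C1 C2] Uq; have [_ _ _ c1 _] := C1 _ Uq; have [_ _ _ _ c2] := C2 _ Uq.
exact: (continuousD c1 c2).
Qed.

(** The factor in front of the bounds is only known to lie between 0 and [rho ^+ 2], because
    [t < rho] is not explicit; the signs of [L] and [M] allow it to be replaced with [rho ^+ 2]. *)
Lemma mean_value_between U x (rho L M : R) u : open U -> 0 < rho ->
  box x (2 * rho) `<=` U -> C2_on U u -> L <= 0 <= M ->
  (forall z, box x rho z -> L <= laplacian u z <= M) ->
  rho ^+ 2 * L <= \int[mu2]_(y in Q) (eta y * u (dil x rho y)) - mass * u x <= rho ^+ 2 * M.
Proof.
move=> oU r0 bU C2u /andP[L0 M0] LM.
have [t tI ->] := mean_value_laplacian oU r0 bU C2u.
have := tI; rewrite in_itv/= => /andP[t0 tr].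
have inU y : Q y -> box x rho (dil x t y).
  by move=> Qy; apply: dil_box_norm => //; rewrite gtr0_norm// ltW.
have ci : mu2.-integrable Q (EFin \o (fun y => phi y ^+ 3 * laplacian u (dil x t y))).
  apply: integrable_box => y Qy; apply: continuousM; first exact: continuous_phi3.
  have Uy : U (dil x t y) by apply: bU; apply: box_subr (inU _ Qy); lra.
  exact: (continuous_dil_comp (continuous_laplacian C2u Uy)).
have cc (c : R) : mu2.-integrable Q (EFin \o cst c).
  by apply: integrable_box => y _; exact: cst_continuous.
have le1 : 4 * L <= \int[mu2]_(y in Q) (phi y ^+ 3 * laplacian u (dil x t y)).
  rewrite -Rintegral_unit_box_cst; apply: le_Rintegral; [exact: measurable_box|exact: cc|exact: ci|].
  move=> y Qy; have /andP[h _] := LM _ (inU _ Qy); have /andP[] := phi3_bound y.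
  by move: (phi y ^+ 3) (laplacian _ _) h => a b; nra.
have le2 : \int[mu2]_(y in Q) (phi y ^+ 3 * laplacian u (dil x t y)) <= 4 * M.
  rewrite -Rintegral_unit_box_cst; apply: le_Rintegral; [exact: measurable_box|exact: ci|exact: cc|].
  move=> y Qy; have /andP[_ h] := LM _ (inU _ Qy); have /andP[] := phi3_bound y.
  by move: (phi y ^+ 3) (laplacian _ _) h => a b; nra.
have k0 : 0 <= rho * t / 6 by rewrite divr_ge0// mulr_ge0 ?ltW.
have k1 : rho * t / 6 * 4 <= rho ^+ 2.
  have h : rho * t <= rho * rho by rewrite ler_wpM2l// ltW.
  by have h0 : 0 <= rho * t; [rewrite mulr_ge0// ltW|rewrite expr2; lra].
have e1 : rho * t / 6 * (4 * L) >= rho ^+ 2 * L by rewrite mulrA ler_wnM2r.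
have e2 : rho * t / 6 * (4 * M) <= rho ^+ 2 * M by rewrite mulrA ler_wpM2r.
by rewrite (le_trans e1) ?ler_wpM2l//= (le_trans _ e2)// ler_wpM2l.
Qed.

Lemma integrable_unit_boxD f F : mu2.-integrable Q (EFin \o f) ->
  mu2.-integrable Q (EFin \o F) -> mu2.-integrable Q (EFin \o (fun y => f y + F y)).
Proof.
move=> fi Fi; have mQ := @measurable_box R (0, 0) 1.
rewrite (_ : _ \o _ = (EFin \o f) \+ (EFin \o F))%E//.
by apply: integrableD.
Qed.

Lemma Rintegral_sub_box x p (rho d : R) F : box x rho `<=` box p d ->
  (forall q, box p d q -> {for q, continuous F}) -> (forall q, box p d q -> 0 <= F q) ->
  \int[mu2]_(q in box x rho) F q <= \int[mu2]_(q in box p d) F q.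
Proof.
move=> sub cF F0; apply: le_Rintegral_subset => //; [exact: measurable_box|exact: measurable_box|].
exact: integrable_box.
Qed.

Lemma continuous_expR2 u q : {for q, continuous u} -> {for q, continuous (fun x => expR (2 * u x))}.
Proof.
move=> cu; apply: (@continuous_comp _ _ _ (fun x => 2 * u x) (@expR R)); last exact: continuous_expR.
by apply: continuousM => //; exact: cst_continuous.
Qed.

(** Origin of 1/512: if [c * s ^+ 2 * S x0] exceeds 1/16, then at scale [rho] with
    [64 * c * S x0 * rho ^+ 2 = 1] the weighted average of [u] drops by at most 1/16. Since
    [mass >= 1/4], the average of [S] is at least [S x0 * (1/4 - 2/16) = S x0 / 8], and the energy
    at least [rho ^+ 2 * S x0 / 8 = 1 / (512 * c)]. *)
Lemma subsolution_bound U p d (c : R) u : open U -> 0 < d -> 0 < c ->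
  box p d `<=` U -> C2_on U u ->
  (forall x, box p d x -> - laplacian u x <= c * expR (2 * u x)) ->
  c * \int[mu2]_(q in box p d) expR (2 * u q) < 1 / 512 ->
  forall x, box p (d / 2) x -> c * d ^+ 2 * expR (2 * u x) <= 1.
Proof.
move=> oU d0 c0 bU C2u lu cE.
have [C1u _ _] := C2u.
pose S x := expR (2 * u x).
have cS q : box p d q -> {for q, continuous S}.
  by move=> /bU/C1u[cu _ _ _ _]; exact: continuous_expR2.
have S0 q : 0 <= S q by exact: expR_ge0.
have [x0 [s [/andP[s0 sd] sub S4 Sd]]] := point_picking d0 cS S0.
have Sx0 : 0 < S x0 by exact: expR_gt0.
suff small : c * (s ^+ 2 * S x0) <= 1 / 16.
  move=> x xd; have := Sd _ xd; rewrite -/(S x) -(ler_pM2l c0).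
  by move: (S x) (s ^+ 2 * S x0) small => a b; rewrite (mulrCA c 16) mulrA; lra.
rewrite leNgt; apply/negP => big.
set E := \int[mu2]_(q in _) _ in cE.
(* On the picked square the Laplacian is at least [- 4 * c * S x0], so this radius costs exactly
   1/16 in the mean value inequality; the negated bound [big] gives [2 * rho < s], so the square of
   size [2 * rho] fits. *)
pose rho := Num.sqrt (1 / (64 * c * S x0)).
have K0 : 0 < 64 * c * S x0 by rewrite !mulr_gt0.
have rho0 : 0 < rho by rewrite sqrtr_gt0 divr_gt0.
have rho2 : rho ^+ 2 = 1 / (64 * c * S x0) by rewrite sqr_sqrtr// divr_ge0// ltW.
have rhoE : rho ^+ 2 * (64 * c * S x0) = 1 by rewrite rho2 divfK// gt_eqF.
have rhos : 2 * rho < s.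
  rewrite -(@ltr_pXn2r _ 2)// ?nnegrE ?mulr_ge0 ?(ltW rho0)//.
  rewrite -(ltr_pM2r K0).
  have -> : (2 * rho) ^+ 2 * (64 * c * S x0) = 4 * (rho ^+ 2 * (64 * c * S x0)) by ring.
  have -> : s ^+ 2 * (64 * c * S x0) = 64 * (c * (s ^+ 2 * S x0)) by ring.
  by rewrite rhoE; move: big; lra.
have bU' : box x0 (2 * rho) `<=` U.
  by move=> z zb; apply: bU; apply: sub; apply: box_subr zb; exact: ltW.
have sub' : box x0 rho `<=` box p d.
  by move=> z zb; apply: sub; apply: box_subr zb; lra.
have [M M0 MP] := compact_cont_bounded (@box_compact _ p d)
  (fun q qB => continuous_laplacian C2u (bU q qB)).
have F0 : - (4 * c * S x0) <= 0 <= M.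
  by rewrite M0 andbT oppr_le0 ltW// !mulr_gt0.
have lapb z : box x0 rho z -> - (4 * c * S x0) <= laplacian u z <= M.
  move=> zb; have zp := sub' _ zb; apply/andP; split.
    have := lu _ zp; have : S z <= 4 * S x0.
      by apply: S4; apply: box_subr zb; lra.
    by rewrite -(ler_pM2l c0) /S; lra.
  by have := MP _ zp; rewrite ler_norml => /andP[].
have /andP[mv _] := mean_value_between oU rho0 bU' C2u F0 lapb.
have {}mv : - (1 / 16) <= \int[mu2]_(y in Q) (eta y * u (dil x0 rho y)) - mass * u x0.
  by apply: le_trans mv; move: rhoE; lra.
have /andP[m1 m2] := @mass_bounds R.
have cu q : Q q -> {for q, continuous (fun y => u (dil x0 rho y))}.
  move=> Qq; apply: continuous_dil_comp.
  by have [] := C1u _ (bU _ (sub' _ (dil_box x0 (ltW rho0) Qq))).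
have i1 : mu2.-integrable Q (EFin \o (fun y => eta y * u (dil x0 rho y))).
  by apply: integrable_box => q Qq; apply: continuousM; [exact: continuous_eta|exact: cu].
have i2 : mu2.-integrable Q (EFin \o (fun y => (1 - 2 * u x0) * eta y)).
  apply: integrable_box => q Qq; apply: continuousM; last exact: continuous_eta.
  exact: cst_continuous.
(* In place of Jensen's inequality: the exponential is bounded below by its tangent at [2 * u x0],
   and the result is multiplied by [eta <= 1]. *)
have low : S x0 / 8 <= \int[mu2]_(y in Q) S (dil x0 rho y).
  apply: (@le_trans _ _ (\int[mu2]_(y in Q)
      (S x0 * (2 * (eta y * u (dil x0 rho y)) + (1 - 2 * u x0) * eta y)))).
    rewrite RintegralZl; [|exact: measurable_box|]; last first.
      by apply: integrable_unit_boxD => //; exact: integrable_unit_boxZ.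
    rewrite RintegralD//; [|exact: measurable_box|exact: integrable_unit_boxZ].
    rewrite !RintegralZl//; [|exact: measurable_box| |exact: measurable_box]; last first.
      by apply: integrable_box => q _; exact: continuous_eta.
    rewrite -/mass ler_pM2l//; move: mv m1; lra.
  apply: le_Rintegral.
  - exact: measurable_box.
  - apply: integrable_unit_boxZ; apply: integrable_unit_boxD => //.
    exact: integrable_unit_boxZ.
  - by apply: integrable_box => q Qq; exact: continuous_expR2 (cu _ Qq).
  - move=> y Qy; have /andP[e0 e1] := eta_bound y.
    have : S x0 * (1 + (2 * u (dil x0 rho y) - 2 * u x0)) <= S (dil x0 rho y).
      have := expR_ge1Dx (2 * u (dil x0 rho y) - 2 * u x0).
      rewrite -(ler_pM2l Sx0) => /le_trans; apply.
      by rewrite /S -expRD addrC subrK.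
    move: (S (dil _ _ _)) (S0 (dil x0 rho y)) (u (dil _ _ _)) => a a0 b ab.
    have -> : S x0 * (2 * (eta y * b) + (1 - 2 * u x0) * eta y) =
      eta y * (S x0 * (1 + (2 * b - 2 * u x0))) by ring.
    by apply: le_trans (ler_wpM2l e0 ab) _; rewrite ler_piMl.
move: low; rewrite Rintegral_dil//; last by move=> q qB; apply: cS; exact: sub'.
have := Rintegral_sub_box sub' cS (fun q _ => S0 q).
rewrite -/E; set J := \int[mu2]_(q in box x0 rho) _ => JE low.
have : S x0 / 8 <= rho ^- 2 * E by apply: le_trans low _; rewrite ler_wpM2l// invr_ge0 sqr_ge0.
have -> : rho ^- 2 = 64 * c * S x0 by rewrite rho2; field; rewrite !gt_eqF.
have -> : 64 * c * S x0 * E = S x0 * (64 * (c * E)) by ring.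
by rewrite ler_pM2l//; lra.
Qed.

End LocalEstimates.

(** * Perturbed Cauchy-Riemann systems and Harnack's inequality *)

Section DiracHarnack.
Variable R : realType.
Implicit Types (p q x y z : R * R) (d : R) (f F H u : R * R -> R) (U : set (R * R)).
Notation mu := (@lebesgue_measure R).
Notation mu2 := (mu \x mu)%E.
Notation Q := (box (0, 0) (1 : R)).
Notation mass := (@mass R).

Lemma continuous_abs f q : {for q, continuous f} -> {for q, continuous (fun x => `|f x|)}.
Proof.
by move=> cf; apply: (@continuous_comp _ _ _ f (@Num.norm _ _)) => //; exact: norm_continuous.
Qed.

(** [(f1, f2)] and [(g1, g2)] solve the Cauchy-Riemann equations, with opposite orientations, up to
    errors controlled by [M * S]. Each component satisfies a mean value estimate whose error is
    absorbed into [S x0] at a small enough scale; [W] stands for the fourth power of the spinor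
    norm, whose integral is controlled. *)
Lemma Dirac_system_bound U p d (M : R) (f1 f2 g1 g2 W : R * R -> R) :
  let S x := `|f1 x| + `|f2 x| + `|g1 x| + `|g2 x| in
  open U -> 0 < d -> 0 <= M -> box p d `<=` U ->
  C1_on U f1 -> C1_on U f2 -> C1_on U g1 -> C1_on U g2 ->
  (forall x, box p d x -> `|partial1 f1 x + partial2 f2 x| <= M * S x) ->
  (forall x, box p d x -> `|partial2 f1 x - partial1 f2 x| <= M * S x) ->
  (forall x, box p d x -> `|partial1 g1 x - partial2 g2 x| <= M * S x) ->
  (forall x, box p d x -> `|partial2 g1 x + partial1 g2 x| <= M * S x) ->
  (forall x, box p d x -> {for x, continuous W}) ->
  (forall x, 0 <= W x) -> (forall x, S x <= 4 + W x) ->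
  forall x, box p (d / 2) x -> d ^+ 2 * S x <=
    16 * (512 * d ^+ 2 + 32 * (2 + 1024 * M * d) ^+ 2 * \int[mu2]_(q in box p d) W q).
Proof.
move=> S oU d0 M0 bU Cf1 Cf2 Cg1 Cg2 e1 e2 e3 e4 cW W0 SW.
have cS q : box p d q -> {for q, continuous S}.
  move=> /bU Uq.
  have [c1 _ _ _ _] := Cf1 _ Uq; have [c2 _ _ _ _] := Cf2 _ Uq.
  have [c3 _ _ _ _] := Cg1 _ Uq; have [c4 _ _ _ _] := Cg2 _ Uq.
  exact: (continuousD (continuousD (continuousD (continuous_abs c1) (continuous_abs c2))
    (continuous_abs c3)) (continuous_abs c4)).
have S0 q : 0 <= S q by rewrite /S !addr_ge0.
have [x0 [s [/andP[s0 sd] sub S4 Sd]]] := point_picking d0 cS S0.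
have s2d : s ^+ 2 <= d ^+ 2 by rewrite lerXn2r ?nnegrE//; lra.
move=> x xd; apply: le_trans (Sd _ xd) _; rewrite ler_pM2l//.
set E := \int[mu2]_(q in _) _; set L := 2 + 1024 * M * d.
have E0 : 0 <= E by exact: Rintegral_ge0.
have Md : 0 <= M * d by rewrite mulr_ge0// ltW.
have L0 : 2 <= L by rewrite /L -mulrA; lra.
have [->|s_neq0] := eqVneq s 0.
  have h1 := sqr_ge0 d; have h2 : 0 <= L ^+ 2 * E by rewrite mulr_ge0// sqr_ge0.
  by rewrite expr0n mul0r -mulrA; lra.
have {s_neq0}s_gt0 : 0 < s by rewrite lt_neqAle eq_sym s_neq0.
(* [L = 2 + 1024 * M * d] gives both [2 * rho <= s], so that the picked square contains the one
   needed, and [1024 * rho * M <= 1], so that the error can be absorbed. Dividing [s] rather than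
   fixing [rho] keeps the final bound polynomial in [d] and [M]. *)
pose rho := s / L.
have rho0 : 0 < rho by rewrite divr_gt0//; lra.
have rhoL : rho * L = s by rewrite /rho divfK// gt_eqF//; lra.
have rhos : 2 * rho <= s by rewrite -rhoL; nra.
have rhoM : 1024 * (rho * M) <= 1.
  have : rho * (1024 * M * d) <= d by move: rhoL; rewrite /L; nra.
  have -> : rho * (1024 * M * d) = 1024 * (rho * M) * d by ring.
  by rewrite -{2}(mul1r d) ler_pM2r.
have bU' : box x0 (2 * rho) `<=` U.
  by move=> z zb; apply: bU; apply: sub; apply: box_subr zb.
have sub' : box x0 rho `<=` box p d.
  by move=> z zb; apply: sub; apply: box_subr zb; lra.
pose k := M * (4 * S x0).
have Sk z : box x0 rho z -> M * S z <= k.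
  by move=> zb; rewrite ler_wpM2l// S4//; apply: box_subr zb; lra.
set J := \int[mu2]_(y in Q) S (dil x0 rho y).
have dilB y : Q y -> box p d (dil x0 rho y).
  by move=> Qy; apply: sub'; apply: dil_box => //; exact: ltW.
have key h : C1_on U h -> (forall z, `|h z| <= S z) ->
    `|\int[mu2]_(y in Q) (eta y * h (dil x0 rho y)) - mass * h x0| <= 8 * rho * k ->
    mass * `|h x0| <= J + 8 * rho * k.
  move=> Ch hS.
  have ce y : Q y -> {for y, continuous (fun y => eta y * h (dil x0 rho y))}.
    move=> Qy; apply: continuousM; first exact: continuous_eta.
    by apply: continuous_dil_comp; have [] := Ch _ (bU _ (dilB _ Qy)).
  have le1 : `|\int[mu2]_(y in Q) (eta y * h (dil x0 rho y))| <= J.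
    apply: le_trans (le_normr_Rintegral _ (integrable_box ce)) _; first exact: measurable_box.
    apply: le_Rintegral; [exact: measurable_box| | |].
    - by apply: integrable_box => y Qy; exact: continuous_abs (ce _ Qy).
    - by apply: integrable_box => y Qy; apply: continuous_dil_comp; apply: cS; exact: dilB.
    - move=> y Qy; have /andP[a0 a1] := eta_bound y.
      by rewrite normrM ger0_norm// (le_trans (ler_piMl _ a1)).
  have /andP[m0 _] := @mass_bounds R.
  have mE : mass * `|h x0| = `|mass * h x0| by rewrite normrM ger0_norm//; lra.
  move=> le2; rewrite mE.
  apply: le_trans (lerD le1 le2).
  by apply: le_trans (ler_normB _ _); rewrite subKr.
have k1 : mass * `|f1 x0| <= J + 8 * rho * k.
  apply: key => // [z|]; first by rewrite /S -!addrA lerDl !addr_ge0.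
  apply: (mean_value_Cauchy_Riemann (s := -1) oU rho0 bU' Cf1 Cf2) => z zb.
  by rewrite !mulN1r opprK; split; apply: le_trans (Sk _ zb); [exact/e1/sub'|exact/e2/sub'].
have k2 : mass * `|f2 x0| <= J + 8 * rho * k.
  apply: key => // [z|]; first by rewrite /S -!addrA addrCA lerDl !addr_ge0.
  apply: (mean_value_Cauchy_Riemann (s := 1) oU rho0 bU' Cf2 Cf1) => z zb.
  rewrite !mul1r distrC [partial2 f2 z + _]addrC.
  by split; apply: le_trans (Sk _ zb); [exact/e2/sub'|exact/e1/sub'].
have k3 : mass * `|g1 x0| <= J + 8 * rho * k.
  apply: key => // [z|]; first by rewrite /S addrAC lerDr !addr_ge0.
  apply: (mean_value_Cauchy_Riemann (s := 1) oU rho0 bU' Cg1 Cg2) => z zb.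
  by rewrite !mul1r; split; apply: le_trans (Sk _ zb); [exact/e3/sub'|exact/e4/sub'].
have k4 : mass * `|g2 x0| <= J + 8 * rho * k.
  apply: key => // [z|]; first by rewrite /S lerDr !addr_ge0.
  apply: (mean_value_Cauchy_Riemann (s := -1) oU rho0 bU' Cg2 Cg1) => z zb.
  rewrite !mulN1r opprK distrC [partial1 g2 z + _]addrC.
  by split; apply: le_trans (Sk _ zb); [exact/e4/sub'|exact/e3/sub'].
have kS : mass * S x0 <= 4 * J + 32 * rho * k by rewrite /S !mulrDr; lra.
have cWd y : Q y -> {for y, continuous (fun y => W (dil x0 rho y))}.
  by move=> Qy; apply: continuous_dil_comp; apply: cW; exact: dilB.
have JE : J <= 16 + rho ^- 2 * E.
  have i4 : mu2.-integrable Q (EFin \o cst (4 : R)).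
    by apply: integrable_box => y _; exact: cst_continuous.
  apply: (@le_trans _ _ (\int[mu2]_(y in Q) (4 + W (dil x0 rho y)))).
    apply: le_Rintegral; [exact: measurable_box| | |by move=> y _; exact: SW].
    - by apply: integrable_box => y Qy; apply: continuous_dil_comp; apply: cS; exact: dilB.
    - exact: (integrable_unit_boxD i4 (integrable_box cWd)).
  rewrite RintegralD; [|exact: measurable_box|exact: i4|exact: integrable_box].
  rewrite Rintegral_unit_box_cst Rintegral_dil//; last by move=> q qB; apply: cW; exact: sub'.
  rewrite lerD//; first by lra.
  by rewrite ler_wpM2l ?invr_ge0 ?sqr_ge0//; exact: Rintegral_sub_box.
have /andP[m0 _] := @mass_bounds R.
have mS : 1 / 4 * S x0 <= mass * S x0 by rewrite ler_wpM2r.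
(* The four Cauchy-Riemann errors together take at most half of the lower bound [S x0 / 4] for
   [mass * S x0]; the remaining [S x0 / 8] is estimated by [4 * J]. *)
have kE : 32 * rho * k <= S x0 / 8.
  have -> : 32 * rho * k = 1024 * (rho * M) * (S x0 / 8) by rewrite /k; field.
  by rewrite ler_piMl// divr_ge0.
have main : S x0 <= 512 + 32 * (rho ^- 2 * E) by lra.
apply: (@le_trans _ _ (s ^+ 2 * (512 + 32 * (rho ^- 2 * E)))); first by rewrite ler_wpM2l// sqr_ge0.
have -> : s ^+ 2 * (512 + 32 * (rho ^- 2 * E)) = 512 * s ^+ 2 + 32 * L ^+ 2 * E.
  by rewrite -rhoL; field; rewrite gt_eqF.
exact: (lerD (ler_wpM2l (ler0n _ _) s2d) (lexx _)).
Qed.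

(** For [w = M - u >= 0] the value at [x] is at most an average of [w] over a small square, up to
    the Laplacian; the value at [y] is at least an average over a larger square that contains the
    small one. The comparison needs only [w >= 0]. The constant 5000 is generous: [65 / 16] divided
    by [mass >= 1/4] would do. *)
Lemma Harnack U p d (M F : R) u : open U -> 0 < d -> box p d `<=` U ->
  C2_on U u -> 0 <= F -> (forall x, box p d x -> u x <= M) ->
  (forall x, box p d x -> `|laplacian u x| <= F) ->
  forall x y, box p (d / 32) x -> box p (d / 32) y ->
  M - u x <= 64 * (M - u y) + 5000 * (F * d ^+ 2).
Proof.
move=> oU d0 bU C2u F0 uM lF x y xB yB.
have [C1u _ _] := C2u.
have subB z (e : R) : box p (d / 32) z -> e <= 7 / 8 * d -> box z e `<=` box p d.
  by move=> /boxP[z1 z2] ed; apply: sub_box; lra.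
have F00 : - F <= 0 <= F by rewrite oppr_le0 F0.
have mv z (r : R) : box p (d / 32) z -> 0 < r -> 2 * r <= 7 / 8 * d ->
    - (r ^+ 2 * F) <= \int[mu2]_(t in Q) (eta t * u (dil z r t)) - mass * u z <= r ^+ 2 * F.
  move=> zB r0 rd; rewrite -mulrN; apply: (mean_value_between oU) => //.
  - by move=> w /(subB _ _ zB rd); exact: bU.
  - move=> w wB; rewrite -ler_norml; apply: lF.
    by apply: (subB z r zB) wB; lra.
pose w z := M - u z.
have w0 z : box p d z -> 0 <= w z by move=> /uM; rewrite /w subr_ge0.
have cw z : box p d z -> {for z, continuous w}.
  by move=> /bU/C1u[cu _ _ _ _]; apply: continuousB => //; exact: cst_continuous.
have inB z (r : R) t : box p (d / 32) z -> 0 < r -> r <= 7 / 8 * d -> Q t -> box p d (dil z r t).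
  by move=> zB r0 rd Qt; apply: (subB z r zB rd); apply: dil_box => //; exact: ltW.
have iu z (r : R) : box p (d / 32) z -> 0 < r -> r <= 7 / 8 * d ->
    mu2.-integrable Q (EFin \o (fun t => eta t * u (dil z r t))).
  move=> zB r0 rd; apply: integrable_box => t Qt; apply: continuousM; first exact: continuous_eta.
  by apply: continuous_dil_comp; have [] := C1u _ (bU _ (inB _ _ _ zB r0 rd Qt)).
have cwd z (r : R) t : box p (d / 32) z -> 0 < r -> r <= 7 / 8 * d -> Q t ->
    {for t, continuous (fun t => w (dil z r t))}.
  by move=> zB r0 rd Qt; apply: continuous_dil_comp; apply: cw; exact: inB.
have iew z (r : R) : box p (d / 32) z -> 0 < r -> r <= 7 / 8 * d ->
    mu2.-integrable Q (EFin \o (fun t => eta t * w (dil z r t))).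
  move=> zB r0 rd; apply: integrable_box => t Qt; apply: continuousM; first exact: continuous_eta.
  exact: cwd.
have ie : mu2.-integrable Q (EFin \o (@eta R)).
  by apply: integrable_box => t _; exact: continuous_eta.
have Ew z (r : R) : box p (d / 32) z -> 0 < r -> r <= 7 / 8 * d ->
    \int[mu2]_(t in Q) (eta t * w (dil z r t)) =
    mass * M - \int[mu2]_(t in Q) (eta t * u (dil z r t)).
  move=> zB r0 rd; rewrite /mass -RintegralZr//; last exact: measurable_box.
  rewrite -RintegralB; [|exact: measurable_box| |exact: iu].
    by apply: eq_Rintegral => t _; rewrite /w; ring.
  apply: integrable_box => t _; apply: continuousM; first exact: continuous_eta.
  exact: cst_continuous.
(* Points of the square of size [d / 32] differ by at most [d / 16] per coordinate, so [box x r1]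
   lies in [box y (r2 / 2)], where [eta] is at least 1/4. The constant 64 is
   [4 * (r2 / r1) ^+ 2]. *)
pose r1 := d / 16; pose r2 := d / 4.
have r10 : 0 < r1 by rewrite /r1; lra.
have r20 : 0 < r2 by rewrite /r2; lra.
have r30 : 0 < r2 / 2 by lra.
have /andP[_ up] : - (r1 ^+ 2 * F) <= \int[mu2]_(t in Q) (eta t * u (dil x r1 t)) - mass * u x <= r1 ^+ 2 * F.
  by apply: mv => //; rewrite /r1; lra.
have /andP[lo _] : - (r2 ^+ 2 * F) <= \int[mu2]_(t in Q) (eta t * u (dil y r2 t)) - mass * u y <= r2 ^+ 2 * F.
  by apply: mv => //; rewrite /r2; lra.
set A := \int[mu2]_(q in box x r1) w q.
have wx : mass * w x <= r1 ^- 2 * A + r1 ^+ 2 * F.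
  have : \int[mu2]_(t in Q) (eta t * w (dil x r1 t)) <= r1 ^- 2 * A.
    rewrite -Rintegral_dil//; last by move=> q qB; apply: cw; apply: (subB x r1) => //; rewrite /r1; lra.
    have rd : r1 <= 7 / 8 * d by rewrite /r1; lra.
    apply: le_Rintegral; [exact: measurable_box|exact: iew| |].
    - by apply: integrable_box => t Qt; exact: cwd.
    - move=> t Qt; have /andP[e0 e1] := eta_bound t.
      by rewrite ler_piMl// w0//; exact: inB.
  rewrite Ew//; last by rewrite /r1; lra.
  by rewrite /w mulrBr; lra.
have wy : r2 ^- 2 / 4 * A <= mass * w y + r2 ^+ 2 * F.
  have rd : r2 <= 7 / 8 * d by rewrite /r2; lra.
  have : r2 ^- 2 / 4 * A <= \int[mu2]_(t in Q) (eta t * w (dil y r2 t)).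
    have hQ : box (0, 0) (1 / 2) `<=` Q by apply: box_subr; lra.
    have i5 : mu2.-integrable Q (EFin \o (fun t => w (dil y r2 t))).
      by apply: integrable_box => t Qt; exact: cwd.
    apply: (@le_trans _ _ (\int[mu2]_(t in box (0, 0) (1 / 2)) (eta t * w (dil y r2 t)))); last first.
      apply: le_Rintegral_subset => //; [exact: measurable_box|exact: measurable_box|exact: iew|].
      move=> t Qt; have /andP[e0 _] := eta_bound t.
      by rewrite mulr_ge0// w0//; exact: inB.
    apply: (@le_trans _ _ (\int[mu2]_(t in box (0, 0) (1 / 2)) (1 / 4 * w (dil y r2 t)))); last first.
      apply: le_Rintegral; [exact: measurable_box| | |].
      - apply: integrable_box => t tB; apply: continuousM; first exact: cst_continuous.
        by apply: cwd => //; exact: hQ.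
      - apply: integrable_box => t tB; apply: continuousM; first exact: continuous_eta.
        by apply: cwd => //; exact: hQ.
      - move=> t tB; rewrite ler_wpM2r// ?eta_ge// w0//; apply: inB => //; exact: hQ.
    rewrite RintegralZl; [|exact: measurable_box|]; last first.
      by apply: integrable_box => t tB; apply: cwd => //; exact: hQ.
    have h0 : (0 : R) < 1 / 2 by lra.
    rewrite (box_scaling h0); last by move=> t tB; apply: cwd => //; exact: hQ.
    have E (t : R * R) : dil y r2 (dil (0, 0) (1 / 2) t) = dil y (r2 / 2) t.
      by rewrite /dil/=; congr pair; field.
    under eq_Rintegral do rewrite E.
    have sB : box y (r2 / 2) `<=` box p d by apply: subB => //; lra.
    rewrite Rintegral_dil//; last by move=> q qB; apply: cw; exact: sB.
    have AB : A <= \int[mu2]_(q in box y (r2 / 2)) w q.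
      have xy : box x r1 `<=` box y (r2 / 2).
        move: xB yB => /boxP[x1 x2] /boxP[y1 y2]; apply: sub_box.
          by have := ler_distD p.1 x.1 y.1; rewrite (distrC p.1) /r1 /r2; lra.
        by have := ler_distD p.2 x.2 y.2; rewrite (distrC p.2) /r1 /r2; lra.
      by apply: Rintegral_sub_box => // q /sB; [exact: cw|exact: w0].
    have -> : r2 ^- 2 / 4 * A = 1 / 4 * ((1 / 2) ^+ 2 * ((r2 / 2) ^- 2 * A)).
      by field; rewrite gt_eqF.
    by rewrite !ler_wpM2l// ?invr_ge0 ?sqr_ge0//; lra.
  by rewrite Ew// /w mulrBr; lra.
have A0 : 0 <= A by apply: Rintegral_ge0 => q qB; apply: w0; apply: (subB x r1) => //; rewrite /r1; lra.
have /andP[m1 m2] := @mass_bounds R.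
have E1 : r1 ^- 2 * A = 64 * (r2 ^- 2 / 4 * A).
  by rewrite /r1 /r2; field; rewrite gt_eqF.
rewrite E1 in wx; move: (r2 ^- 2 / 4 * A) wx wy => B wx wy.
have K : mass * w x <= 64 * (mass * w y) + 65 * (r2 ^+ 2 * F).
  have : r1 ^+ 2 * F <= r2 ^+ 2 * F by rewrite ler_wpM2r// lerXn2r ?nnegrE ?ltW// /r1 /r2; lra.
  by move: wx wy; lra.
rewrite -/(w x) -/(w y).
have d2F : 0 <= F * d ^+ 2 by rewrite mulr_ge0// sqr_ge0.
rewrite -(ler_pM2l (_ : 0 < mass)); last by move: m1; lra.
apply: le_trans K _.
have -> : mass * (64 * w y + 5000 * (F * d ^+ 2)) =
  64 * (mass * w y) + 5000 * mass * (F * d ^+ 2) by ring.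
have -> : 65 * (r2 ^+ 2 * F) = 65 / 16 * (F * d ^+ 2) by rewrite /r2; field.
apply: (lerD (lexx _)); apply: (ler_wpM2r d2F); move: m1; lra.
Qed.

End DiracHarnack.

(** * Estimates for solutions *)

Section Disc.
Variable R : realType.
Implicit Types (p q x y z : R * R).

Lemma enorm_ge0 p : 0 <= enorm p. Proof. exact: sqrtr_ge0. Qed.

Lemma sqr_enorm p : enorm p ^+ 2 = p.1 ^+ 2 + p.2 ^+ 2.
Proof. by rewrite sqr_sqrtr// addr_ge0 ?sqr_ge0. Qed.

Lemma discP (r : R) p : 0 < r -> disc r p <-> p.1 ^+ 2 + p.2 ^+ 2 < r ^+ 2.
Proof.
move=> r0; rewrite -sqr_enorm ltr_pXn2r ?nnegrE ?enorm_ge0 ?(ltW r0)//.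
Qed.

Lemma continuous_enorm p : {for p, continuous (@enorm R)}.
Proof.
apply: (@continuous_comp _ _ _ (fun q : R * R => q.1 ^+ 2 + q.2 ^+ 2) (@Num.sqrt R)); last exact: sqrt_continuous.
apply: continuousD.
  by apply: (@continuous_comp _ _ _ fst (fun s : R => s ^+ 2)); [exact: cvg_fst|exact: exprn_continuous].
by apply: (@continuous_comp _ _ _ snd (fun s : R => s ^+ 2)); [exact: cvg_snd|exact: exprn_continuous].
Qed.

Lemma disc_open (r : R) : open (disc r).
Proof.
rewrite openE => p pr.
have /cvgrPdist_lt/(_ (r - enorm p)) := @continuous_enorm p.
rewrite subr_gt0 => /(_ pr); apply: filterS => q.
by move=> h; have := ler_norm (enorm q - enorm p); rewrite distrC /disc/=; lra.
Qed.

Lemma measurable_disc (r : R) : measurable (disc r).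
Proof. by apply: measurable_open_plane; exact: disc_open. Qed.

Lemma enorm_gt0 p : p <> 0 -> 0 < enorm p.
Proof.
move=> p0; rewrite lt_neqAle enorm_ge0 andbT eq_sym.
apply/eqP => e0; apply: p0; have := sqr_enorm p; rewrite e0 expr0n/=.
move=> /esym/eqP; rewrite paddr_eq0 ?sqr_ge0// !sqrf_eq0 => /andP[/eqP h1 /eqP h2].
by rewrite [p]surjective_pairing h1 h2.
Qed.

Lemma normr_le_enorm p : `|p.1| <= enorm p /\ `|p.2| <= enorm p.
Proof.
by split; rewrite -(@ler_pXn2r _ 2)// ?nnegrE ?enorm_ge0// sqr_enorm real_normK ?num_real//;
  rewrite ?lerDl ?lerDr sqr_ge0.
Qed.

(** The squared norms differ by twice the inner product of [p] and [q - p] plus the square of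
    [q - p], both small against the square of [enorm p]. This makes the weight comparable to its
    value at the centre with a factor that does not depend on the centre. *)
Lemma box_enorm p q (d : R) : box p d q -> 8 * d <= enorm p ->
  enorm q <= 2 * enorm p /\ enorm p <= 2 * enorm q.
Proof.
move=> /boxP[q1 q2] de; have d0 : 0 <= d by apply: le_trans q1.
have [p1 p2] := normr_le_enorm p; have e0 := enorm_ge0 p; have f0 := enorm_ge0 q.
have E1 := sqr_enorm p; have E2 := sqr_enorm q.
move: (enorm p) (enorm q) e0 f0 p1 p2 de E1 E2 => e f e0 f0 p1 p2 de E1 E2.
have prod (a c u v : R) : `|a| <= u -> `|c| <= v -> `|a * c| <= u * v.
  by move=> au cv; rewrite normrM ler_pM.
have := prod _ _ _ _ q1 q1; have := prod _ _ _ _ q2 q2.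
have := prod _ _ _ _ p1 q1; have := prod _ _ _ _ p2 q2.
rewrite !ler_norml => /andP[a1 a2] /andP[b1 b2] /andP[c1 c2] /andP[g1 g2].
have ed : e * d <= e * e / 8 by nra.
have dd : d * d <= e * e / 64 by nra.
have dE : f ^+ 2 - e ^+ 2 = (q.1 - p.1) * (q.1 - p.1) + (q.2 - p.2) * (q.2 - p.2)
     + 2 * (p.1 * (q.1 - p.1)) + 2 * (p.2 * (q.2 - p.2)) by rewrite E1 E2; ring.
move: dE; rewrite !expr2 => dE.
by split; rewrite -(@ler_pXn2r _ 2)// ?nnegrE ?mulr_ge0// exprMn !expr2;
  have ee := mulr_ge0 e0 e0; lra.
Qed.

Variable A : R.
(** The largest factor by which a weight of exponent at most [2 * A] can grow when the norm at most
    doubles. *)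
Definition wt_ratio : R := 2 `^ (2 * A).

Lemma wt_ge0 (s : R) p : 0 <= wt s p. Proof. exact: powR_ge0. Qed.

Lemma wt_gt0 (s : R) p : p <> 0 -> 0 < wt s p.
Proof. by move=> /enorm_gt0 p0; rewrite powR_gt0. Qed.

Lemma wt_compare (s : R) x y : 0 <= s <= 2 * A -> enorm x <= 2 * enorm y ->
  wt s x <= wt_ratio * wt s y.
Proof.
move=> /andP[s0 sA] xy.
apply: (@le_trans _ _ ((2 * enorm y) `^ s)).
  by apply: ge0_ler_powR; rewrite ?nnegrE ?mulr_ge0 ?enorm_ge0.
rewrite powRM ?enorm_ge0// ler_wpM2r ?powR_ge0// ler_powR//.
by rewrite ler1n.
Qed.

Lemma wt_upper (r s : R) x : 0 < r -> disc r x -> 0 <= s <= 2 * A ->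
  wt s x <= (1 + r) `^ (2 * A).
Proof.
move=> r0 xr /andP[s0 sA]; apply: (@le_trans _ _ ((1 + r) `^ s)).
  apply: ge0_ler_powR; rewrite ?nnegrE ?enorm_ge0//; first by lra.
  by move: xr; rewrite /disc/=; lra.
by apply: ler_powR => //; lra.
Qed.

(** Since [(1 + 1 / |p|) * |p| = |p| + 1 >= 1], the product of the [s]-th powers is at least 1, and
    a base at least 1 allows the exponent [s] to be raised to [2 * A]. The bound is uniform in [s],
    hence in [n] later on. *)
Lemma wt_lower (s : R) p : p <> 0 -> 0 <= s <= 2 * A ->
  ((1 + (enorm p)^-1) `^ (2 * A))^-1 <= wt s p.
Proof.
move=> /enorm_gt0 p0 /andP[s0 sA].
have k1 : 1 <= 1 + (enorm p)^-1 by rewrite lerDl invr_ge0 ltW.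
have k0 : 0 < (1 + (enorm p)^-1) `^ (2 * A) by apply: powR_gt0; lra.
rewrite -(ler_pM2l k0) divff ?gt_eqF//.
apply: (@le_trans _ _ ((1 + (enorm p)^-1) `^ s * enorm p `^ s)); last first.
  by rewrite ler_wpM2r ?powR_ge0// ler_powR.
rewrite -powRM; [|lra|exact: ltW].
rewrite mulrDl mulVf ?gt_eqF// mul1r.
apply: (@le_trans _ _ (1 `^ s)); first by rewrite powR1.
by apply: ge0_ler_powR; rewrite ?nnegrE ?addr_ge0 ?(ltW p0)// lerDr ltW.
Qed.

Lemma measurable_wt (s : R) (D : set (R * R)) : measurable D -> measurable_fun D (wt s).
Proof.
move=> mD; apply: (@measurableT_comp _ _ _ _ _ _ (fun t : R => t `^ s)).
  exact: measurable_powR.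
by apply: measurable_fun_cont => // q _; exact: continuous_enorm.
Qed.

End Disc.

Section SolutionEstimates.
Variable R : realType.
Implicit Types (p q x y z : R * R) (u : R * R -> R) (Psi : R * R -> R[i] * R[i]).
Notation mu := (@lebesgue_measure R).
Notation mu2 := (mu \x mu)%E.

Variables (r : R) (V : R * R -> R) (a b A : R).
Hypotheses (a0 : 0 < a) (Vab : forall x, disc r x -> a <= V x <= b).

Let V0 x : disc r x -> 0 <= V x.
Proof. by move=> /Vab/andP[aV _]; apply: le_trans aV; exact: ltW. Qed.

Let V_sqr x : disc r x -> V x ^+ 2 <= b ^+ 2.
Proof.
move=> xr; have /andP[aV Vb] := Vab xr; have Vx := V0 xr.
by rewrite lerXn2r ?nnegrE// (le_trans Vx).
Qed.

Lemma spin_sq_ge0 (s : R[i] * R[i]) : 0 <= spin_sq s.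
Proof. by rewrite /spin_sq /sqmod !addr_ge0 ?sqr_ge0. Qed.

Lemma solution_subsolution (al : R) u Psi x : 0 < al <= A ->
  is_solution r V al u Psi -> disc r x ->
  - laplacian u x <= 2 * b ^+ 2 * wt (2 * al) x * expR (2 * u x).
Proof.
move=> alA [_ _ _ eqs] xr; have [-> _] := eqs _ xr.
apply: (@le_trans _ _ (2 * V x ^+ 2 * wt (2 * al) x * expR (2 * u x))).
  by rewrite gerBl !mulr_ge0 ?expR_ge0 ?wt_ge0 ?spin_sq_ge0 ?V0.
by rewrite ler_wpM2r ?expR_ge0// ler_wpM2r ?wt_ge0// ler_wpM2l// V_sqr.
Qed.

Definition energy_threshold : R := (1024 * (2 * b ^+ 2 * wt_ratio A ^+ 2))^-1.

Lemma wt_ratio_gt0 : 0 < wt_ratio A. Proof. by rewrite powR_gt0. Qed.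

Let b0 x : disc r x -> 0 < b.
Proof. by move=> /Vab/andP[aV Vb]; apply: lt_le_trans a0 _; exact: le_trans Vb. Qed.

Lemma measurable_expR2 u (D : set (R * R)) : measurable D ->
  (forall q, D q -> {for q, continuous u}) -> measurable_fun D (fun x => expR (2 * u x)).
Proof.
by move=> mD cu; apply: measurable_fun_cont => // q Dq; apply: continuous_expR2; exact: cu.
Qed.

Lemma solution_epsilon_regularity (al : R) u Psi p (d : R) : 0 < al <= A ->
  is_solution r V al u Psi -> p <> 0 -> 0 < d -> 8 * d <= enorm p ->
  box p d `<=` disc r ->
  (\int[mu2]_(x in box p d) (wt (2 * al) x * expR (2 * u x))%:E < energy_threshold%:E)%E ->
  forall x, box p (d / 2) x ->
    2 * b ^+ 2 * wt_ratio A * wt (2 * al) p * d ^+ 2 * expR (2 * u x) <= 1.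
Proof.
move=> alA sol p0 d0 dp sub small.
have [al0 alA'] := andP alA; have [C2u _ _ _] := sol; have [C1u _ _] := C2u.
have bgt : 0 < b by apply: (@b0 p); apply: sub; exact: box_center (ltW d0).
have k0 := wt_ratio_gt0.
have s2A : 0 <= 2 * al <= 2 * A by apply/andP; split; lra.
set c := 2 * b ^+ 2 * wt_ratio A * wt (2 * al) p.
have c0 : 0 < c by rewrite !mulr_gt0 ?exprn_gt0 ?wt_gt0.
have wtE x : box p d x -> wt (2 * al) x <= wt_ratio A * wt (2 * al) p /\
    wt (2 * al) p <= wt_ratio A * wt (2 * al) x.
  by move=> xB; have [h1 h2] := box_enorm xB dp; split; exact: wt_compare.
have cu q : box p d q -> {for q, continuous u} by move=> /sub/C1u[].
have ci : mu2.-integrable (box p d) (EFin \o (fun x => expR (2 * u x))).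
  by apply: integrable_box => q /cu; exact: continuous_expR2.
have mB := @measurable_box R p d.
have me := measurable_expR2 mB cu.
apply: (subsolution_bound (@disc_open R r) d0 c0 sub C2u).
  move=> x xB; apply: le_trans (solution_subsolution alA sol (sub _ xB)) _.
  have -> : c = 2 * b ^+ 2 * (wt_ratio A * wt (2 * al) p) by rewrite /c; ring.
  have bb : 0 <= 2 * b ^+ 2 by rewrite mulr_ge0// sqr_ge0.
  by rewrite ler_wpM2r ?expR_ge0// ler_wpM2l//; have [] := wtE _ xB.
rewrite -RintegralZl// -lte_fin /Rintegral fineK; last first.
  apply: integrable_fin_num => //.
  apply: (integrable_box (f := fun x => c * expR (2 * u x))) => q /cu cuq.
  by apply: continuousM; [exact: cst_continuous|exact: continuous_expR2].
pose K := 2 * b ^+ 2 * wt_ratio A ^+ 2.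
have K0 : 0 < K by rewrite !mulr_gt0 ?exprn_gt0.
apply: (@le_lt_trans _ _ (\int[mu2]_(x in box p d) (K * (wt (2 * al) x * expR (2 * u x)))%:E)%E).
  apply: ge0_le_integral => //.
  - by move=> x _; rewrite lee_fin mulr_ge0 ?expR_ge0// ltW.
  - by apply/measurable_EFinP; apply: measurable_funM => //; exact: measurable_cst.
  - apply/measurable_EFinP; apply: measurable_funM; first exact: measurable_cst.
    by apply: measurable_funM => //; exact: measurable_wt.
  - move=> x xB; rewrite lee_fin mulrA ler_wpM2r ?expR_ge0//.
    have -> : K * wt (2 * al) x = 2 * b ^+ 2 * wt_ratio A * (wt_ratio A * wt (2 * al) x).
      by rewrite /K; ring.
    have bb : 0 <= 2 * b ^+ 2 * wt_ratio A by rewrite !mulr_ge0 ?sqr_ge0// ltW.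
    by rewrite /c ler_wpM2l//; have [] := wtE _ xB.
under eq_integral do rewrite EFinM.
rewrite ge0_integralZl//; last by rewrite lee_fin ltW.
- apply: lt_le_trans (_ : (K%:E * energy_threshold%:E <= _)%E).
    by rewrite lte_pmul2l// lte_fin.
  by rewrite -EFinM lee_fin /energy_threshold -/K invfM mulrCA divff ?gt_eqF// mulr1; lra.
- by apply/measurable_EFinP; apply: measurable_funM => //; exact: measurable_wt.
- by move=> x _; rewrite lee_fin mulr_ge0 ?expR_ge0 ?wt_ge0.
Qed.

End SolutionEstimates.

(** * The Dirac equation as a real system *)

Section DiracSolution.
Variable R : realType.
Implicit Types (p q x y z : R * R) (u : R * R -> R) (Psi : R * R -> R[i] * R[i]).
Notation mu := (@lebesgue_measure R).
Notation mu2 := (mu \x mu)%E.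

Definition psi1 Psi q : R := complex.Re (Psi q).1.
Definition psi2 Psi q : R := complex.Im (Psi q).1.
Definition psi3 Psi q : R := complex.Re (Psi q).2.
Definition psi4 Psi q : R := complex.Im (Psi q).2.

Lemma complex_ops (a b c d : R) : [/\ Complex a b * Complex c d = Complex (a * c - b * d) (a * d + b * c),
  Complex a b + Complex c d = Complex (a + c) (b + d) & - Complex a b = Complex (- a) (- b)].
Proof. by []. Qed.

(** For [h = 0] the first component of the spinor is antiholomorphic and the second one holomorphic,
    which accounts for the different signs in the two pairs. *)
Lemma Dirac_real_system Psi x (h : R) :
  Dirac Psi x = (rC (- h) * (Psi x).1, rC (- h) * (Psi x).2) ->
  [/\ partial1 (psi1 Psi) x + partial2 (psi2 Psi) x = h * psi3 Psi x,
      partial2 (psi1 Psi) x - partial1 (psi2 Psi) x = - (h * psi4 Psi x),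
      partial1 (psi3 Psi) x - partial2 (psi4 Psi) x = - (h * psi1 Psi x) &
      partial2 (psi3 Psi) x + partial1 (psi4 Psi) x = - (h * psi2 Psi x)].
Proof.
rewrite /Dirac /dzbar /dz => -[].
have two (z : R[i]) : 2 * (2^-1 * z) = z by rewrite mulrA divff ?mul1r// pnatr_eq0.
rewrite !two /psi1 /psi2 /psi3 /psi4 /cpartial1 /cpartial2 /imag_unit /rC.
have mulE (a b c d : R) : Complex a b * Complex c d = Complex (a * c - b * d) (a * d + b * c).
  by case: (complex_ops a b c d).
have addE (a b c d : R) : Complex a b + Complex c d = Complex (a + c) (b + d).
  by case: (complex_ops a b c d).
have oppE (a b : R) : - Complex a b = Complex (- a) (- b) by case: (complex_ops a b 0 0).
case: (Psi x) => -[f1 f2] [g1 g2].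
rewrite !mulE ?oppE !addE ?oppE ?mulE => -[e1 e2] [e3 e4] /=.
by split; move: e1 e2 e3 e4; lra.
Qed.

(** Replaces Hölder's inequality: an integral of a fourth power controls the integral of the
    absolute value at the price of an additive constant, as scales are fixed anyway. The two squares
    below add up to [s ^+ 4 - s + 1 / 2]. *)
Lemma abs_le1D4 (t : R) : `|t| <= 1 + (t ^+ 2) ^+ 2.
Proof.
have : `|t| ^+ 2 = t ^+ 2 by rewrite real_normK ?num_real.
move=> <-; move: `|t| => s.
have := sqr_ge0 (s ^+ 2 - 1 / 2); have := sqr_ge0 (s - 1 / 2).
have -> : (s ^+ 2 - 1 / 2) ^+ 2 = (s ^+ 2) ^+ 2 - s ^+ 2 + 1 / 4 by field.
have -> : (s - 1 / 2) ^+ 2 = s ^+ 2 - s + 1 / 4 by field.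
by move: ((s ^+ 2) ^+ 2) (s ^+ 2) => u v; lra.
Qed.

Section Estimates.
Variables (r : R) (V : R * R -> R) (a b A : R).
Hypotheses (r0 : 0 < r) (a0 : 0 < a) (Vab : forall x, disc r x -> a <= V x <= b).

Definition weight_bound : R := (1 + r) `^ (2 * A).

Let V0 x : disc r x -> 0 <= V x.
Proof. by move=> /Vab/andP[aV _]; apply: le_trans aV; exact: ltW. Qed.

Lemma potential_bound (al M : R) u x : 0 < al <= A -> disc r x -> u x <= M ->
  0 <= V x * wt al x * expR (u x) <= b * weight_bound * expR M.
Proof.
move=> /andP[al0 alA] xr uM; have Vx := V0 xr; have /andP[_ Vb] := Vab xr.
rewrite !mulr_ge0 ?expR_ge0 ?wt_ge0//=.
apply: ler_pM; rewrite ?mulr_ge0 ?expR_ge0 ?wt_ge0// ?ler_expR//.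
apply: ler_pM; rewrite ?wt_ge0//; apply: wt_upper => //.
by apply/andP; split; lra.
Qed.

Lemma spinor_sum_bound Psi x : let S := `|psi1 Psi x| + `|psi2 Psi x| + `|psi3 Psi x| + `|psi4 Psi x| in
  spin_norm (Psi x) <= S /\ S <= 4 + spin_sq (Psi x) ^+ 2.
Proof.
move=> S.
have sq (t : R) : t ^+ 2 = `|t| ^+ 2 by rewrite real_normK ?num_real.
have SS : spin_sq (Psi x) <= S ^+ 2.
  rewrite /spin_sq /sqmod -/(psi1 Psi x) -/(psi2 Psi x) -/(psi3 Psi x) -/(psi4 Psi x) /S.
  rewrite (sq (psi1 _ _)) (sq (psi2 _ _)) (sq (psi3 _ _)) (sq (psi4 _ _)).
  move: (normr_ge0 (psi1 Psi x)) (normr_ge0 (psi2 Psi x)) (normr_ge0 (psi3 Psi x)) (normr_ge0 (psi4 Psi x)).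
  move: `|psi1 Psi x| `|psi2 Psi x| `|psi3 Psi x| `|psi4 Psi x| => t1 t2 t3 t4 h1 h2 h3 h4.
  have := mulr_ge0 h1 h2; have := mulr_ge0 h1 h3; have := mulr_ge0 h1 h4.
  have := mulr_ge0 h2 h3; have := mulr_ge0 h2 h4; have := mulr_ge0 h3 h4.
  by rewrite !expr2; lra.
have S0 : 0 <= S by rewrite /S !addr_ge0.
split; last rewrite /S {SS S0 S}.
  by rewrite -(ger0_norm S0) -sqrtr_sqr ler_wsqrtr.
have := abs_le1D4 (psi1 Psi x); have := abs_le1D4 (psi2 Psi x).
have := abs_le1D4 (psi3 Psi x); have := abs_le1D4 (psi4 Psi x).
rewrite /spin_sq /sqmod -/(psi1 Psi x) -/(psi2 Psi x) -/(psi3 Psi x) -/(psi4 Psi x).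
move: (sqr_ge0 (psi1 Psi x)) (sqr_ge0 (psi2 Psi x)) (sqr_ge0 (psi3 Psi x)) (sqr_ge0 (psi4 Psi x)).
move: (psi1 Psi x ^+ 2) (psi2 Psi x ^+ 2) (psi3 Psi x ^+ 2) (psi4 Psi x ^+ 2) => t1 t2 t3 t4 h1 h2 h3 h4.
have := mulr_ge0 h1 h2; have := mulr_ge0 h1 h3; have := mulr_ge0 h1 h4.
have := mulr_ge0 h2 h3; have := mulr_ge0 h2 h4; have := mulr_ge0 h3 h4.
by rewrite !expr2; lra.
Qed.

Lemma continuous_spin_sq2 Psi x : CC1_on (disc r) (fun q => (Psi q).1) ->
  CC1_on (disc r) (fun q => (Psi q).2) -> disc r x ->
  {for x, continuous (fun x => spin_sq (Psi x) ^+ 2)}.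
Proof.
move=> [C1 C2] [C3 C4] xr.
have [c1 _ _ _ _] := C1 _ xr; have [c2 _ _ _ _] := C2 _ xr.
have [c3 _ _ _ _] := C3 _ xr; have [c4 _ _ _ _] := C4 _ xr.
exact: (continuousM (continuousD (continuousD (continuousM c1 c1) (continuousM c2 c2))
   (continuousD (continuousM c3 c3) (continuousM c4 c4)))
   (continuousD (continuousD (continuousM c1 c1) (continuousM c2 c2))
   (continuousD (continuousM c3 c3) (continuousM c4 c4)))).
Qed.

Lemma solution_Dirac_bound (al M C d : R) u Psi p : 0 < al <= A ->
  is_solution r V al u Psi -> 0 < d -> box p d `<=` disc r ->
  (\int[mu2]_(x in disc r) (spin_sq (Psi x) ^+ 2)%:E < C%:E)%E ->
  (forall x, box p d x -> u x <= M) ->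
  forall x, box p (d / 2) x -> d ^+ 2 * spin_norm (Psi x) <=
    16 * (512 * d ^+ 2 + 32 * (2 + 1024 * (b * weight_bound * expR M) * d) ^+ 2 * C).
Proof.
move=> alA sol d0 sub EC uM x xB.
have [_ C12 C34 eqs] := sol; have [C1 C2] := C12; have [C3 C4] := C34.
set M' := b * weight_bound * expR M.
pose S x := `|psi1 Psi x| + `|psi2 Psi x| + `|psi3 Psi x| + `|psi4 Psi x|.
have hb q : box p d q -> 0 <= V q * wt al q * expR (u q) <= M'.
  by move=> qB; apply: potential_bound => //; [exact: sub|exact: uM].
have M'0 : 0 <= M'.
  by have /andP[h1 h2] := hb _ (box_center p (ltW d0)); apply: le_trans h2.
have sys q : box p d q -> let h := V q * wt al q * expR (u q) in
  [/\ partial1 (psi1 Psi) q + partial2 (psi2 Psi) q = h * psi3 Psi q,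
      partial2 (psi1 Psi) q - partial1 (psi2 Psi) q = - (h * psi4 Psi q),
      partial1 (psi3 Psi) q - partial2 (psi4 Psi) q = - (h * psi1 Psi q) &
      partial2 (psi3 Psi) q + partial1 (psi4 Psi) q = - (h * psi2 Psi q)].
  by move=> qB h; apply: Dirac_real_system; have [_] := eqs _ (sub _ qB).
have hS q (t : R) : box p d q -> `|t| <= S q ->
    `|V q * wt al q * expR (u q) * t| <= M' * S q.
  by move=> qB tS; have /andP[h0 h1] := hb _ qB; rewrite normrM ger0_norm// ler_pM.
have [n1 _] := spinor_sum_bound Psi x.
apply: (@le_trans _ _ (d ^+ 2 * S x)); first by rewrite ler_wpM2l// sqr_ge0.
have cW q : disc r q -> {for q, continuous (fun x => spin_sq (Psi x) ^+ 2)}.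
  exact: continuous_spin_sq2.
have W0 q : 0 <= spin_sq (Psi q) ^+ 2 by exact: sqr_ge0.
apply: le_trans (Dirac_system_bound (@disc_open R r) d0 M'0 sub C1 C2 C3 C4
   _ _ _ _ (fun q qB => cW q (sub q qB)) W0 _ xB) _.
- move=> q qB; have [-> _ _ _] := sys _ qB; apply: hS => //.
  by rewrite /S addrAC lerDr !addr_ge0.
- move=> q qB; have [_ -> _ _] := sys _ qB; rewrite normrN; apply: hS => //.
  by rewrite /S lerDr !addr_ge0.
- move=> q qB; have [_ _ -> _] := sys _ qB; rewrite normrN; apply: hS => //.
  by rewrite /S -!addrA lerDl !addr_ge0.
- move=> q qB; have [_ _ _ ->] := sys _ qB; rewrite normrN; apply: hS => //.
  by rewrite /S -!addrA addrCA lerDl !addr_ge0.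
- by move=> q; have [_ n2] := spinor_sum_bound Psi q.
set E := \int[mu2]_(q in _) _.
have EE : E <= C.
  rewrite -lee_fin /E /Rintegral fineK; last first.
    apply: integrable_fin_num; first exact: measurable_box.
    by apply: (integrable_box (f := fun q => spin_sq (Psi q) ^+ 2)) => q /sub; exact: cW.
  apply: le_trans (ltW EC); apply: ge0_subset_integral => //.
  - exact: measurable_box.
  - exact: measurable_disc.
  - apply/measurable_EFinP; apply: measurable_fun_cont; first exact: measurable_disc.
    exact: cW.
  - by move=> q _; rewrite lee_fin.
apply: ler_wpM2l; first exact: ler0n.
apply: lerD; first exact: lexx.
apply: ler_wpM2l; last exact: EE.
apply: mulr_ge0; [exact: ler0n|exact: sqr_ge0].
Qed.

Lemma solution_Harnack (al M N d : R) u Psi p : 0 < al <= A ->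
  is_solution r V al u Psi -> 0 < d -> box p d `<=` disc r ->
  (forall x, box p d x -> u x <= M) ->
  (forall x, box p d x -> spin_norm (Psi x) <= N) ->
  forall x y, box p (d / 32) x -> box p (d / 32) y ->
  M - u x <= 64 * (M - u y) + 5000 *
    ((2 * b ^+ 2 * weight_bound * expR (2 * M) + b * weight_bound * expR M * N ^+ 2) * d ^+ 2).
Proof.
move=> alA sol d0 sub uM PN.
have [C2u _ _ eqs] := sol; have [al0 alA'] := andP alA.
set F := 2 * _ * _ * _ + _.
have lapF q : box p d q -> `|laplacian u q| <= F.
  move=> qB; have qr := sub _ qB; have uq := uM _ qB.
  have /andP[h0 h1] := potential_bound alA qr uq.
  have -> : laplacian u q = V q * wt al q * expR (u q) * spin_sq (Psi q)
     - 2 * V q ^+ 2 * wt (2 * al) q * expR (2 * u q).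
    by have [e _] := eqs _ qr; rewrite -[LHS]opprK e opprB.
  apply: le_trans (ler_normB _ _) _; rewrite addrC /F; apply: lerD.
    have /andP[aV Vb] := Vab qr; have Vq := V0 qr.
    rewrite ger0_norm; last by rewrite !mulr_ge0 ?sqr_ge0 ?wt_ge0 ?expR_ge0.
    apply: ler_pM; rewrite ?mulr_ge0 ?sqr_ge0 ?wt_ge0 ?expR_ge0//; last by rewrite ler_expR ler_pM2l.
    apply: ler_pM; rewrite ?mulr_ge0 ?sqr_ge0 ?wt_ge0//.
      by rewrite ler_pM2l// lerXn2r ?nnegrE// (le_trans Vq).
    by apply: wt_upper => //; apply/andP; split; lra.
  rewrite normrM (ger0_norm h0) (ger0_norm (spin_sq_ge0 _)).
  apply: ler_pM; rewrite ?spin_sq_ge0//.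
  have N0 : spin_norm (Psi q) <= N by exact: PN.
  have n0 : 0 <= spin_norm (Psi q) by exact: sqrtr_ge0.
  have -> : spin_sq (Psi q) = spin_norm (Psi q) ^+ 2 by rewrite sqr_sqrtr// spin_sq_ge0.
  by rewrite lerXn2r ?nnegrE// (le_trans n0).
have F0 : 0 <= F by apply: le_trans (lapF _ (box_center p (ltW d0))).
exact: (Harnack (@disc_open R r) d0 sub C2u F0 uM lapF).
Qed.

End Estimates.
End DiracSolution.

(** * Subsequences, compactness and connectedness *)

Section Subsequence.
Variable R : realType.

Let unbounded (I : set nat) := forall N, exists2 n, (N <= n)%N & I n.

(** For each [j], either some bound [M] holds for infinitely many of the indices kept so far, and
    only these are retained; or each [M] holds for finitely many, and nothing has to be removed.
    Both outcomes pass to further subsequences, so the diagonal inherits them for every [j]. *)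
Lemma diagonal_subsequence (T : countType) (B : T -> R -> nat -> Prop) :
  exists phi : nat -> nat, (forall m n, (m < n)%N -> (phi m < phi n)%N) /\
    forall j, (exists M, \forall n \near \oo, B j M (phi n)) \/
              (forall M, \forall n \near \oo, ~ B j M (phi n)).
Proof.
(* Steps are numbered by codes of elements of [T]; a number that is not a code gets a trivially true
   predicate. *)
pose B' k M n := if unpickle k is Some j then B j M n else True.
have refine (kI : nat * set nat) : exists I', unbounded kI.2 ->
    [/\ unbounded I', I' `<=` kI.2 & (exists M, forall n, I' n -> B' kI.1 M n) \/
      (forall M, exists N, forall n, (N <= n)%N -> I' n -> ~ B' kI.1 M n)].
  case: kI => k I /=.
  have [[M HM]|none] := pselect (exists M, unbounded [set n | I n /\ B' k M n]).
    exists [set n | I n /\ B' k M n] => _; split => //; first by move=> n [].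
    by left; exists M => n [].
  exists I => uI; split => //; right => M; apply: contrapT => bad.
  apply: none; exists M => N; apply: contrapT => noN.
  by apply: bad; exists N => n Nn In Bn; apply: noN; exists n.
have [F FP] := choice refine.
pose I_ := fix I_ k : set nat := if k is k'.+1 then F (k', I_ k') else setT.
have uI k : unbounded (I_ k).
  elim: k => [|k IH] /=; first by move=> N; exists N.
  by have [] := FP (k, I_ k) IH.
have subI k l : (k <= l)%N -> I_ l `<=` I_ k.
  move=> /subnK <-; elim: (l - k)%N => [//|m IH]; rewrite addSn /=.
  by have [_ h _] := FP ((m + k)%N, I_ (m + k)%N) (uI _); apply: subset_trans h IH.
have pick (kN : nat * nat) : exists n, (kN.2 <= n)%N /\ I_ kN.1 n.
  by have [n h1 h2] := uI kN.1 kN.2; exists n.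
have [G GP] := choice pick.
pose phi := fix phi k : nat := if k is k'.+1 then G (k, (phi k').+1) else G (0%N, 0%N).
have phiI k : I_ k (phi k).
  by case: k => [|k]; [exact: (GP (0%N, 0%N)).2|exact: (GP (k.+1, (phi k).+1)).2].
have step n : (phi n < phi n.+1)%N by exact: (GP (n.+1, (phi n).+1)).1.
have phi_ge n : (n <= phi n)%N.
  by elim: n => // n IH; exact: leq_ltn_trans IH (step n).
exists phi; split.
  move=> m n; elim: n => // n IH; rewrite ltnS leq_eqVlt => /predU1P[->//|/IH h].
  exact: ltn_trans h (step n).
(* [I_ 0] is the full set, so the refinement made for [j] is [I_ (pickle j).+1]; it contains [phi n]
   as soon as [n] exceeds the code of [j]. *)
move=> j; have tail n : (pickle j < n)%N -> I_ (pickle j).+1 (phi n).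
  by move=> jn; apply: subI jn _ _.
have [_ _] := FP (pickle j, I_ (pickle j)) (uI _).
rewrite /B' pickleK => -[[M MP]|MP]; [left; exists M|right => M].
  by exists (pickle j).+1 => // n /= /tail; exact: MP.
have [N NP] := MP M; exists (maxn N (pickle j).+1) => // n /=.
by rewrite geq_max => /andP[Nn /tail In] Bj; exact: (NP _ (leq_trans Nn (phi_ge n)) In Bj).
Qed.

End Subsequence.

(** * From local bounds to compact sets, and connectedness *)

Section LocalToCompact.
Variable R : realType.
Implicit Types (x y p : R * R) (U K : set (R * R)) (F G : nat -> R * R -> R).

(** The clause shared by [Sigma1] and [Sigma2], with [G] equal to [u] or to the spinor norm. *)
Definition blows_up G x :=
  exists y : nat -> R * R, y @ \oo --> x /\ (fun n => G n (y n)) @ \oo --> +oo.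

Lemma blows_up_near G x : blows_up G x -> forall d M : R, 0 < d ->
  \forall n \near \oo, exists2 y, box x d y & M < G n y.
Proof.
move=> [y [yx Gy]] d M d0.
have h1 : \forall n \near \oo, box x d (y n) by apply: yx; exact: nbhs_box.
have h2 : \forall n \near \oo, M < G n (y n) by move/cvgryPgt: Gy; exact.
by apply: filterS2 h1 h2 => n; exists (y n).
Qed.

(* [y n] realises the largest [k <= n] such that [G n] exceeds [k] within [1 / (k + 1)] of [x]. *)
Lemma near_blows_up G x :
  (forall d M : R, 0 < d -> \forall n \near \oo, exists2 y, box x d y & M < G n y) ->
  blows_up G x.
Proof.
move=> H; pose P n k y := box x k.+1%:R^-1 y /\ k%:R < G n y.
have mono n k l y : (k <= l)%N -> P n l y -> P n k y.
  move=> kl [yB yG]; split; last by apply: le_lt_trans yG; rewrite ler_nat.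
  by apply: box_subr yB; rewrite lef_pV2 ?posrE ?ltr0n// ler_nat.
have best n N : exists y, forall k, (k <= N)%N -> (exists z, P n k z) -> P n k y.
  elim: N => [|N [y IH]].
    have [[z Pz]|no] := pselect (exists z, P n 0 z).
      by exists z => k; rewrite leqn0 => /eqP ->.
    by exists x => k; rewrite leqn0 => /eqP ->.
  have [[z Pz]|no] := pselect (exists z, P n N.+1 z).
    by exists z => k kN _; exact: mono kN Pz.
  by exists y => k; rewrite leq_eqVlt => /predU1P[->//|]; exact: IH.
have [y yP] := choice (fun n => best n n).
have key k : \forall n \near \oo, P n k (y n).
  have k0 : (0 : R) < k.+1%:R^-1 by rewrite invr_gt0 ltr0n.
  have h := H _ k%:R k0; near=> n; apply: yP; first by near: n; exact: nbhs_infty_ge.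
  have [z zB zG] : exists2 y, box x k.+1%:R^-1 y & k%:R < G n y by near: n; exact: h.
  by exists z.
exists y; split.
  move=> A /nbhs_boxP[d d0 dA].
  have h := key (Num.trunc d^-1); apply: filterS h => n [yB _].
  apply: dA; apply: box_subr yB; rewrite -[leRHS]invrK lef_pV2 ?posrE ?invr_gt0 ?ltr0n//.
  exact/ltW/truncnS_gt.
apply/cvgryPgt => M.
apply: filterS (key (Num.trunc M).+1) => n [_]; apply: lt_trans; exact: truncnS_gt.
Unshelve. all: by end_near. Qed.

Lemma prefix_bounded K F N : compact K ->
  (forall n q, K q -> {for q, continuous (F n)}) ->
  exists2 M : R, 0 <= M & forall n x, (n < N)%N -> K x -> `|F n x| <= M.
Proof.
move=> cK cF; elim: N => [|N [M M0 IH]]; first by exists 0.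
have [M' M'0 M'P] := compact_cont_bounded cK (cF N).
exists (M + M'); first by rewrite addr_ge0.
move=> n x; rewrite ltnS leq_eqVlt => /predU1P[-> Kx|nN Kx].
  by rewrite (le_trans (M'P _ Kx))// lerDr.
by rewrite (le_trans (IH _ _ nN Kx))// lerDl.
Qed.

(** Compactness handles the large indices; the finitely many remaining ones are bounded on the
    compact set by continuity, since [bounded_loc] asks for one bound valid for all [n]. *)
Lemma bounded_loc_local U F :
  (forall n q, U q -> {for q, continuous (F n)}) ->
  (forall x, U x -> exists M d : R, 0 < d /\
    \forall n \near \oo, forall y, box x d y -> `|F n y| <= M) ->
  bounded_loc U F.
Proof.
move=> cF loc K cK KU.
(* One number [i] plays both the starting index and the bound, so that the covering property of
   compact sets applies along the filter of large [i]. *)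
have [i _ iP] : \forall i \near \oo,
    K `<=` [set x | forall n, (i <= n)%N -> `|F n x| <= i%:R].
  move/compact_near_coveringP: cK; apply => x /KU/loc[M [d [d0 [N _ NP]]]].
  exists (box x d, [set i | (maxn N (Num.trunc M).+1 <= i)%N]); first split => /=.
  - exact: nbhs_box.
  - by exists (maxn N (Num.trunc M).+1).
  move=> [y i] [/= yB]; rewrite geq_max => /andP[Ni Mi] n ni.
  apply: le_trans (NP n (leq_trans Ni ni) _ yB) _.
  by apply: (@le_trans _ _ (Num.trunc M).+1%:R); [exact/ltW/truncnS_gt|rewrite ler_nat].
have [M M0 MP] := prefix_bounded i cK (fun n q Kq => cF n q (KU q Kq)).
exists (M + i%:R) => n x Kx; have [ni|ni] := ltnP n i.
  by rewrite (le_trans (MP _ _ ni Kx))// lerDl.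
by rewrite (le_trans (iP i (leqnn i) _ Kx _ ni))// lerDr.
Qed.

Lemma to_minfty_loc_local U F :
  (forall x, U x -> exists2 d : R, 0 < d & forall M,
    \forall n \near \oo, forall y, box x d y -> F n y < M) ->
  to_minfty_loc U F.
Proof.
move=> loc K cK KU M.
have : \forall n \near \oo, K `<=` (fun x => F n x < M).
  move/compact_near_coveringP: cK; apply => x /KU/loc[d d0 /(_ M) h].
  exists (box x d, [set n | forall y, box x d y -> F n y < M]); first by split => //; exact: nbhs_box.
  by move=> [y n] [/= yB]; apply.
by [].
Qed.

Lemma all_small (T : eqType) (s : seq T) (P : T -> R -> Prop) :
  (forall p : T, p \in s -> exists2 d0, 0 < d0 & forall d, 0 < d <= d0 -> P p d) ->
  exists2 d0, 0 < d0 & forall d (p : T), 0 < d <= d0 -> p \in s -> P p d.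
Proof.
elim: s => [|p s IH] H; first by exists 1.
have [d1 d10 d1P] := H p (mem_head _ _).
have [d2 d20 d2P] := IH (fun (q : T) qs => H q (mem_behead (s := p :: s) qs)).
exists (Num.min d1 d2); first by rewrite lt_min d10.
move=> d q /andP[d0]; rewrite le_min => /andP[dd1 dd2].
rewrite inE => /predU1P[->|]; first by apply: d1P; rewrite d0.
by apply: d2P; rewrite d0.
Qed.

(* At most one [d] puts [p] on the line through [x] directed by [w + d t]. *)
Lemma ray_avoids x (w1 w2 t1 t2 : R) p : p <> x -> w1 * t1 + w2 * t2 = 0 ->
  0 < w1 ^+ 2 + w2 ^+ 2 -> 0 < t1 ^+ 2 + t2 ^+ 2 ->
  exists2 d0, 0 < d0 & forall d, 0 < d <= d0 ->
    forall s, p <> (x.1 + s * (w1 + d * t1), x.2 + s * (w2 + d * t2)).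
Proof.
move=> px wt w0 t0.
pose al := (p.1 - x.1) * w1 + (p.2 - x.2) * w2.
pose be := (p.1 - x.1) * t1 + (p.2 - x.2) * t2.
(* If [p] is on the line at parameter [s], then [al = s * |w|^2] and [be = s * d * |t|^2], so [d]
   must equal [e]. A value of [e] that is not positive, including the default 0 when [al] vanishes,
   is never reached by [d > 0]. *)
pose e := be * (w1 ^+ 2 + w2 ^+ 2) / (al * (t1 ^+ 2 + t2 ^+ 2)).
exists (if 0 < e then e / 2 else 1); first by case: ifPn => // e0; rewrite divr_gt0.
move=> d /andP[d0 de] s pE.
have E1 : p.1 - x.1 = s * (w1 + d * t1) by rewrite pE /= addrC addKr.
have E2 : p.2 - x.2 = s * (w2 + d * t2) by rewrite pE /= addrC addKr.
have alE : al = s * (w1 ^+ 2 + w2 ^+ 2).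
  transitivity (s * (w1 ^+ 2 + w2 ^+ 2) + s * d * (w1 * t1 + w2 * t2)).
    by rewrite /al E1 E2; ring.
  by rewrite wt mulr0 addr0.
have beE : be = s * d * (t1 ^+ 2 + t2 ^+ 2).
  transitivity (s * d * (t1 ^+ 2 + t2 ^+ 2) + s * (w1 * t1 + w2 * t2)).
    by rewrite /be E1 E2; ring.
  by rewrite wt mulr0 addr0.
have s0 : s != 0.
  apply/eqP => s0; apply: px; move: E1 E2; rewrite s0 !mul0r => /eqP h1 /eqP h2.
  move: h1 h2; rewrite !subr_eq0 => /eqP h1 /eqP h2.
  by rewrite [p]surjective_pairing [x]surjective_pairing h1 h2.
have ed : e = d.
  by rewrite /e alE beE; field; rewrite s0 !gt_eqF.
by move: de; rewrite ed d0; lra.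
Qed.

(** The preimage of [S] in the unit interval is nonempty, open, and closed as the complement of the
    preimage of [T]. *)
Lemma segment_connected_open (S T : set (R * R)) x (v1 v2 : R) : open S -> open T ->
  (forall y, S y -> T y -> False) ->
  (forall s : R, 0 <= s <= 1 -> S (x.1 + s * v1, x.2 + s * v2) \/ T (x.1 + s * v1, x.2 + s * v2)) ->
  S x -> S (x.1 + v1, x.2 + v2).
Proof.
move=> oS oT dis cov Sx.
pose g (s : R) : R * R := (x.1 + s * v1, x.2 + s * v2).
have cg : continuous g.
  move=> s; have c (t v : R) : {for s, continuous (fun s : R => t + s * v : R)}.
    apply: continuousD; first exact: cst_continuous.
    by apply: continuousM; [exact: cvg_id|exact: cst_continuous].
  exact: (cvg_pair (c _ _) (c _ _)).
have gP : forall A, open A -> open (g @^-1` A) by exact/continuousP.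
have /connected_intervalP : is_interval (`[0, 1]%classic : set R) by exact: interval_is_interval.
move=> /(_ (`[0, 1]%classic `&` g @^-1` S)) conn.
have <- : g 1 = (x.1 + v1, x.2 + v2) by rewrite /g !mul1r.
have : `[0, 1]%classic (1 : R) by rewrite /= in_itv/= ler01 lexx.
rewrite -{1}conn; first by case.
- exists 0; split; first by rewrite /= in_itv/= lexx ler01.
  by rewrite /g /= !mul0r !addr0 -surjective_pairing.
- exists (g @^-1` S) => //; exact: gP.
- exists (~` (g @^-1` T)); first by rewrite closedC; exact: gP.
  rewrite eqEsubset; split=> s [/= sI gs]; split => //; first by move=> /dis; exact.
  by have [//|] := cov _ sI.
Qed.

(** Two points are joined by two segments that meet near their midpoint, displaced by [d] along the
    normal. Each excluded point rules out at most one [d] per segment, so a small [d] avoids them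
    all, and convexity keeps the path in the disc. *)
Lemma disc_minus_finite_connected (r : R) (s : seq (R * R)) (S T : set (R * R)) :
  0 < r -> open S -> open T -> (forall y, S y -> T y -> False) ->
  (forall y, disc r y -> y \notin s -> S y \/ T y) ->
  forall x y, disc r x -> disc r y -> x \notin s -> y \notin s -> S x -> T y -> False.
Proof.
move=> r0 oS oT dis cov x y xr yr xs ys Sx Ty.
have xy : x <> y by move=> e; move: Ty; rewrite -e; exact: dis.
pose w1 := (y.1 - x.1) / 2; pose w2 := (y.2 - x.2) / 2.
have w0 : 0 < w1 ^+ 2 + w2 ^+ 2.
  rewrite lt_neqAle addr_ge0 ?sqr_ge0// andbT eq_sym; apply/eqP => /eqP.
  rewrite paddr_eq0 ?sqr_ge0// !sqrf_eq0 !mulf_eq0 !invr_eq0 !pnatr_eq0 !orbF !subr_eq0.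
  move=> /andP[/eqP h1 /eqP h2]; apply: xy.
  by rewrite [x]surjective_pairing [y]surjective_pairing h1 h2.
pose m : R * R := (x.1 + w1, x.2 + w2).
have disc_convex p q (t : R) : disc r p -> disc r q -> 0 <= t <= 1 ->
    disc r (p.1 + t * (q.1 - p.1), p.2 + t * (q.2 - p.2)).
  move=> /(discP _ r0) pr /(discP _ r0) qr /andP[t0 t1]; apply/discP => //=.
  have convex (a c : R) : (a + t * (c - a)) ^+ 2 <= (1 - t) * a ^+ 2 + t * c ^+ 2.
    have -> : (1 - t) * a ^+ 2 + t * c ^+ 2 =
      (a + t * (c - a)) ^+ 2 + t * (1 - t) * (a - c) ^+ 2 by ring.
    by rewrite lerDl; apply: mulr_ge0 (sqr_ge0 _); rewrite mulr_ge0// subr_ge0.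
  have := convex p.1 q.1; have := convex p.2 q.2.
  have h : (1 - t) * (p.1 ^+ 2 + p.2 ^+ 2) + t * (q.1 ^+ 2 + q.2 ^+ 2) < r ^+ 2.
    have [->|tn] := eqVneq t 0; first by rewrite subr0 mul1r mul0r addr0.
    have tp : 0 < t by rewrite lt_neqAle eq_sym tn.
    have := ltr_pM2l tp (q.1 ^+ 2 + q.2 ^+ 2) (r ^+ 2); rewrite qr => h1.
    have : (1 - t) * (p.1 ^+ 2 + p.2 ^+ 2) <= (1 - t) * r ^+ 2 by rewrite ler_wpM2l ?subr_ge0// ltW.
    by move: h1; move: (p.1 ^+ 2 + p.2 ^+ 2) (q.1 ^+ 2 + q.2 ^+ 2) => P1 P2 h1 h2; lra.
  by move: h; lra.
have mr : disc r m.
  have half : 0 <= (1 / 2 : R) <= 1 by apply/andP; split; lra.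
  have := disc_convex _ _ _ xr yr half; congr (disc r (_, _)); rewrite /w1 /w2; ring.
have /nbhs_boxP[e e0 eB] := open_nbhs_nbhs (conj (@disc_open R r) mr).
have wt : w1 * - w2 + w2 * w1 = 0 by ring.
have wt' : - w1 * - w2 + - w2 * w1 = 0 by ring.
have w0' : 0 < (- w1) ^+ 2 + (- w2) ^+ 2 by rewrite !sqrrN.
have t0 : 0 < (- w2) ^+ 2 + w1 ^+ 2 by rewrite sqrrN addrC.
have neq p q : p \in s -> q \notin s -> p <> q by move=> ps qs pq; rewrite -pq ps in qs.
have [d1 d10 d1P] := all_small (fun p ps => ray_avoids (neq p x ps xs) wt w0 t0).
have [d2 d20 d2P] := all_small (fun p ps => ray_avoids (neq p y ps ys) wt' w0' t0).
pose K := `|w1| + `|w2| + 1.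
have K0 : 0 < K by rewrite ltr_wpDl// addr_ge0.
pose d := Num.min (e / K) (Num.min d1 d2).
have d0 : 0 < d by rewrite !lt_min divr_gt0// d10.
have [de dd1 dd2] : [/\ d <= e / K, d <= d1 & d <= d2].
  by rewrite /d !ge_min !lexx !orbT.
have dd (w : R) : `|w| <= K -> `|d * w| <= e.
  move=> wK; rewrite normrM (gtr0_norm d0); apply: le_trans (ler_wpM2l (ltW d0) wK) _.
  by rewrite -ler_pdivlMr.
have dI1 : 0 < d <= d1 by rewrite d0.
have dI2 : 0 < d <= d2 by rewrite d0.
(* [w] is half of [y - x] and [(- w2, w1)] is its normal; seen from [y], the same point has
   direction [- w] with the same normal term, so [ray_avoids] covers both segments. *)
pose z : R * R := (x.1 + (w1 + d * - w2), x.2 + (w2 + d * w1)).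
have zr : disc r z.
  apply: eB; apply/boxP; rewrite /z /m/= !addrA ![_ + d * _]addrC !addrK.
  split; apply: dd; rewrite ?normrN /K.
    by rewrite addrAC lerDr addr_ge0.
  by rewrite -addrA lerDl addr_ge0.
have zy : z = (y.1 + (- w1 + d * - w2), y.2 + (- w2 + d * w1)).
  by rewrite /z /w1 /w2; congr pair; field.
have Sz : S z.
  apply: segment_connected_open oS oT dis _ Sx => t t01; apply: cov.
    have := disc_convex _ _ _ xr zr t01; rewrite /z /=.
    by rewrite ![_ + _ - x.1]addrC ![_ + _ - x.2]addrC !addKr.
  by apply/negP => ps; exact: (d1P _ _ dI1 ps t).
have Tz : T z.
  rewrite zy; apply: segment_connected_open oT oS (fun q Tq Sq => dis q Sq Tq) _ Ty => t t01.
  set q := (_, _); have qr : disc r q.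
    have := disc_convex _ _ _ yr zr t01; rewrite zy /=.
    by rewrite ![_ + _ - y.1]addrC ![_ + _ - y.2]addrC !addKr.
  have qs : q \notin s by apply/negP => ps; exact: (d2P _ _ dI2 ps t).
  by have [h|h] := cov _ qr qs; [right|left].
exact: dis Sz Tz.
Qed.

End LocalToCompact.

(** * Sequences of solutions *)

Section Sequences.
Variable R : realType.
Implicit Types (p q x y z : R * R) (G : nat -> R * R -> R).
Notation mu := (@lebesgue_measure R).
Notation mu2 := (mu \x mu)%E.

(** Blow-up asks for points [y n] along the entire sequence, so its failure gives a bound for
    infinitely many [n] only. *)
Lemma not_blows_up_frequently G x : ~ blows_up G x -> exists d M : R, 0 < d /\
  forall N, exists2 n, (N <= n)%N & forall y, box x d y -> G n y <= M.
Proof.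
move=> nb; apply: contrapT => H; apply: nb; apply: near_blows_up => d M d0.
apply: contrapT => nn; apply: H; exists d, M; split => // N.
apply: contrapT => nN; apply: nn; exists N => // n /= Nn.
apply: contrapT => ny; apply: nN; exists n => // y yB.
by rewrite leNgt; apply/negP => yG; apply: ny; exists y.
Qed.

Definition box_dichotomy G := forall j,
  (exists M, \forall n \near \oo, forall y, rbox j y -> G n y <= M) \/
  (forall M, \forall n \near \oo, ~ forall y, rbox j y -> G n y <= M).

(** A bound valid for infinitely many [n] excludes the second alternative on a rational square
    inside, which upgrades it to a bound for all large [n]. *)
Lemma dichotomy_local_bound G x : box_dichotomy G -> ~ blows_up G x ->
  exists M d : R, 0 < d /\ \forall n \near \oo, forall y, box x d y -> G n y <= M.
Proof.
move=> dG /not_blows_up_frequently[d [M [d0 freq]]].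
have [j [xj jd]] := rbox_base (nbhs_box x d0).
have [[M' M'P]|none] := dG j.
  have /nbhs_boxP[e e0 ej] := xj.
  exists M', e; split => //; apply: filterS M'P => n h y /ej; exact: h.
have [N _ NP] := none M; have [n Nn nM] := freq N.
by case: (NP n Nn) => y /jd; exact: nM.
Qed.

Variables (r : R) (V : R * R -> R) (a b A C : R).
Hypotheses (r0 : 0 < r) (a0 : 0 < a) (Vab : forall x, disc r x -> a <= V x <= b).
Variables (al : nat -> R) (u : nat -> R * R -> R) (Psi : nat -> R * R -> R[i] * R[i]).
Hypotheses (alA : forall n, 0 < al n <= A)
  (sol : forall n, is_solution r V (al n) (u n) (Psi n))
  (energy_u : forall n, (\int[mu2]_(x in disc r)
     (wt (2 * al n) x * expR (2 * u n x))%:E < C%:E)%E)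
  (energy_Psi : forall n, (\int[mu2]_(x in disc r) (spin_sq (Psi n x) ^+ 2)%:E < C%:E)%E).

Let spin n x := spin_norm (Psi n x).

Lemma continuous_solution n q : disc r q -> {for q, continuous (u n)}.
Proof. by have [[C1u _ _] _ _ _] := sol n; move=> /C1u[]. Qed.

Lemma continuous_spin n q : disc r q -> {for q, continuous (spin n)}.
Proof.
move=> qr; have [_ [C1 C2] [C3 C4] _] := sol n.
have [c1 _ _ _ _] := C1 _ qr; have [c2 _ _ _ _] := C2 _ qr.
have [c3 _ _ _ _] := C3 _ qr; have [c4 _ _ _ _] := C4 _ qr.
apply: (@continuous_comp _ _ _ (fun x => spin_sq (Psi n x)) (@Num.sqrt R)); last exact: sqrt_continuous.
exact: (continuousD (continuousD (continuousM c1 c1) (continuousM c2 c2))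
   (continuousD (continuousM c3 c3) (continuousM c4 c4))).
Qed.

Lemma box_in_disc x : disc r x -> exists2 e, 0 < e & box x e `<=` disc r.
Proof. by move=> xr; apply/nbhs_boxP; apply: open_nbhs_nbhs; split => //; exact: disc_open. Qed.

Lemma uniform_spin_bound x (d M : R) : 0 < d -> box x d `<=` disc r -> exists N, forall n,
  (forall y, box x d y -> u n y <= M) -> forall y, box x (d / 2) y -> spin n y <= N.
Proof.
move=> d0 sub; set K := 16 * (512 * d ^+ 2 + 32 * (2 + 1024 * (b * weight_bound r A * expR M) * d) ^+ 2 * C).
exists (K / d ^+ 2) => n uM y yB.
rewrite ler_pdivlMr ?exprn_gt0// mulrC.
exact: (solution_Dirac_bound r0 a0 Vab (alA n) (sol n) d0 sub (energy_Psi n) uM yB).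
Qed.

(** Where [u] does not blow up it is bounded above on a square for infinitely many [n], and the
    spinors are bounded there for the same [n]; spinor blow-up would exceed that bound for all large
    [n]. No subsequence is involved. *)
Lemma Sigma2_sub_Sigma1 : Sigma2 r Psi `<=` Sigma1 r u.
Proof.
move=> x [xr blowP]; split => //; apply: contrapT => /not_blows_up_frequently[d [M [d0 freq]]].
have [e e0 eB] := box_in_disc xr.
pose d' := Num.min d e; have d'0 : 0 < d' by rewrite lt_min d0.
have [dd de] : d' <= d /\ d' <= e by rewrite /d' !ge_min !lexx orbT.
have sub : box x d' `<=` disc r by move=> z /(box_subr de); exact: eB.
have [N NP] := uniform_spin_bound M d'0 sub.
have [m _ mP] := blows_up_near (blowP : blows_up spin x) N (divr_gt0 d'0 (ltr0Sn R 1)).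
have [n mn nM] := freq m; have [y yB] := mP n mn.
by rewrite ltNge NP// => z /(box_subr dd); exact: nM.
Qed.

Let eps := energy_threshold b A.

Lemma b_gt0 : 0 < b.
Proof.
have /andP[aV Vb] : a <= V (0, 0) <= b.
  by apply: Vab; apply/discP => //=; rewrite expr0n/= addr0 exprn_gt0.
by apply: lt_le_trans a0 _; exact: le_trans Vb.
Qed.

Lemma eps_gt0 : 0 < eps.
Proof.
rewrite /eps /energy_threshold invr_gt0; apply: mulr_gt0; first exact: ltr0n.
by rewrite !mulr_gt0 ?exprn_gt0 ?wt_ratio_gt0 ?b_gt0.
Qed.

Lemma energy_concentration x (d : R) : Sigma1 r u x -> x <> 0 -> 0 < d -> 8 * d <= enorm x ->
  box x d `<=` disc r -> \forall n \near \oo,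
  (eps%:E <= \int[mu2]_(y in box x d) (wt (2 * al n) y * expR (2 * u n y))%:E)%E.
Proof.
move=> [xr blowu] x0 d0 dx sub.
(* A lower bound for the weight at [x] that is the same for all exponents, so that the height at
   which [u] contradicts the small-energy estimate does not vary with [n]. *)
pose w := ((1 + (enorm x)^-1) `^ (2 * A))^-1.
pose c := 2 * b ^+ 2 * wt_ratio A * w * d ^+ 2.
have w0 : 0 < w.
  rewrite invr_gt0 powR_gt0// ltr_wpDr// invr_ge0; exact: enorm_ge0.
have c0 : 0 < c by rewrite !mulr_gt0 ?exprn_gt0 ?wt_ratio_gt0 ?b_gt0.
have d20 : 0 < d / 2 by rewrite divr_gt0.
(* Height [1 / c] is enough: there [expR (2 * u) >= 1 + 2 / c], which exceeds the bound [1 / c] that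
   small energy would impose. *)
apply: filterS (blows_up_near (blowu : blows_up u x) c^-1 d20) => n [y yB big].
rewrite leNgt; apply/negP => small.
have := solution_epsilon_regularity a0 Vab (alA n) (sol n) x0 d0 dx sub small yB.
have s2A : 0 <= 2 * al n <= 2 * A by have /andP[h1 h2] := alA n; apply/andP; split; lra.
have wx : w <= wt (2 * al n) x by exact: wt_lower.
have le1 : c <= 2 * b ^+ 2 * wt_ratio A * wt (2 * al n) x * d ^+ 2.
  have bb : 0 <= 2 * b ^+ 2 * wt_ratio A.
    by apply: ltW; rewrite !mulr_gt0 ?exprn_gt0 ?wt_ratio_gt0 ?b_gt0.
  by rewrite /c ler_wpM2r ?sqr_ge0// ler_wpM2l.
move=> h; have : c * expR (2 * u n y) <= 1.
  by apply: le_trans h; rewrite ler_wpM2r ?expR_ge0.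
rewrite mulrC -ler_pdivlMr// mul1r => h2.
have c1 : 0 < c^-1 by rewrite invr_gt0.
have := expR_ge1Dx (2 * u n y); lra.
Qed.

Lemma box_disjoint p q : p <> q -> exists2 d0 : R, 0 < d0 &
  forall d, 0 < d <= d0 -> box p d `&` box q d = set0.
Proof.
move=> pq.
have n0 : 0 < `|p - q| by rewrite normr_gt0 subr_eq0; apply/eqP.
exists (`|p - q| / 4); first by rewrite divr_gt0.
move=> d /andP[d0 dn]; rewrite -subset0 => z [/box_normP zp /box_normP zq].
by have := ler_distD z p q; rewrite (distrC p z); lra.
Qed.

(* The origin is left out because the weight is not comparable to a constant near it. *)
Lemma Sigma1_card (s : seq (R * R)) : uniq s ->
  (forall p, p \in s -> Sigma1 r u p /\ p <> 0) -> (size s)%:R * eps <= C.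
Proof.
move=> us sP.
have [d1 d10 d1P] : exists2 d0, 0 < d0 & forall d p, 0 < d <= d0 -> p \in s ->
    8 * d <= enorm p /\ box p d `<=` disc r.
  apply: (@all_small R _ s (fun p d => 8 * d <= enorm p /\ box p d `<=` disc r)) => p ps.
  have [[pr _] p0] := sP _ ps; have [e e0 eB] := box_in_disc pr.
  have n0 := enorm_gt0 p0.
  exists (Num.min e (enorm p / 8)); first by rewrite lt_min e0 divr_gt0.
  move=> d /andP[d0]; rewrite le_min => /andP[de dp]; split; first by lra.
  by move=> z /(box_subr de); exact: eB.
have [d2 d20 d2P] : exists2 d0, 0 < d0 & forall d p, 0 < d <= d0 -> p \in s ->
    forall q, q \in s -> p <> q -> box p d `&` box q d = set0.
  apply: (@all_small R _ s (fun p d => forall q, q \in s -> p <> q -> box p d `&` box q d = set0)) => p ps.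
  have [d0 d00 d0P] : exists2 d0, 0 < d0 & forall d q, 0 < d <= d0 -> q \in s ->
      p <> q -> box p d `&` box q d = set0.
    apply: (@all_small R _ s (fun q d => p <> q -> box p d `&` box q d = set0)) => q qs.
    have [->|/eqP pq] := eqVneq p q; first by exists 1.
    by have [d0 d00 d0P] := box_disjoint pq; exists d0 => // d /d0P.
  by exists d0 => // d dd q qs pq; exact: d0P.
pose d := Num.min d1 d2.
have d0 : 0 < d by rewrite lt_min d10.
have dd1 : 0 < d <= d1 by rewrite d0 /d ge_min lexx.
have dd2 : 0 < d <= d2 by rewrite d0 /d ge_min lexx orbT.
have conc : \forall n \near \oo, forall p, p \in s ->
    (eps%:E <= \int[mu2]_(y in box p d) (wt (2 * al n) y * expR (2 * u n y))%:E)%E.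
  have : forall t : seq (R * R), {subset t <= s} -> \forall n \near \oo, forall p, p \in t ->
    (eps%:E <= \int[mu2]_(y in box p d) (wt (2 * al n) y * expR (2 * u n y))%:E)%E.
    elim=> [|p t IH] ts; first by apply: nearW.
    have ps : p \in s by apply: ts; rewrite mem_head.
    have [p1 p2] := sP _ ps; have [h1 h2] := d1P _ _ dd1 ps.
    have ts' : {subset t <= s} by move=> q qt; apply: ts; rewrite inE qt orbT.
    apply: filterS2 (energy_concentration p1 p2 d0 h1 h2) (IH ts') => n np nt q.
    by rewrite inE => /predU1P[->//|]; exact: nt.
  exact.
(* One index late enough for all points of [s]: the disjoint squares each carry at least [eps] of a
   total energy below [C]. *)
have [n nP] := filter_ex conc.
pose f y := (wt (2 * al n) y * expR (2 * u n y))%:E.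
have f0 y : (0 <= f y)%E by rewrite lee_fin mulr_ge0 ?expR_ge0 ?wt_ge0.
have mf : measurable_fun (disc r) f.
  apply/measurable_EFinP; apply: measurable_funM; first by apply: measurable_wt; exact: measurable_disc.
  apply: measurable_expR2; first exact: measurable_disc.
  by move=> q; exact: continuous_solution.
have sub : \big[setU/set0]_(p <- s) box p d `<=` disc r.
  rewrite big_seq; elim/big_ind: _ => [//|B1 B2 h1 h2 z [/h1|/h2]//|p ps].
  by have [] := d1P _ _ dd1 ps.
rewrite -lee_fin; apply: le_trans (ltW (energy_u n)).
apply: (@le_trans _ _ (\int[mu2]_(y in \big[setU/set0]_(p <- s) box p d) f y)%E); last first.
  apply: ge0_subset_integral => //; last exact: measurable_disc.
  by apply: bigsetU_measurable => p _; exact: measurable_box.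
rewrite ge0_integral_bigsetU//.
- rewrite (_ : (_ * _)%:E = (\sum_(p <- s) eps%:E)%E); last first.
    by rewrite sumEFin big_const_seq count_predT iter_addr_0 mulr_natl.
  by rewrite !big_seq; apply: lee_sum => p; exact: nP.
- by move=> p; exact: measurable_box.
- move=> p q ps qs [z [zp zq]]; apply: contrapT => pq.
  by have := d2P _ _ dd2 ps q qs pq; rewrite -subset0 => /(_ z); exact.
- exact: measurable_funS (measurable_disc r) sub mf.
Qed.

Lemma Sigma1_finite : finite_set (Sigma1 r u).
Proof.
suff fin : finite_set (Sigma1 r u `\` [set 0]).
  apply: (@sub_finite_set _ _ ((Sigma1 r u `\` [set 0]) `|` [set 0])).
    by move=> x Sx; have [->|/eqP x0] := eqVneq x 0; [right|left].
  by rewrite finite_setU.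
apply: contrapT => inf.
have [s sP sN] := infinite_set_fset (Num.trunc (C / eps)).+1 inf.
have : (size (finmap.enum_fset s))%:R * eps <= C.
  apply: Sigma1_card; first exact: finmap.fset_uniq.
  by move=> p ps; have [] := sP p ps.
rewrite -ler_pdivlMr ?eps_gt0//; apply/negP; rewrite -ltNge.
apply: lt_le_trans (truncnS_gt _) _; rewrite ler_nat; exact: sN.
Qed.

Hypotheses (du : box_dichotomy u) (dPsi : box_dichotomy spin)
  (dNu : box_dichotomy (fun n x => - u n x)).

Lemma spin_bounded_off_Sigma2 :
  bounded_loc (disc r `\` Sigma2 r Psi) (fun n x => spin_norm (Psi n x)).
Proof.
apply: bounded_loc_local => [n q [qr _]|x [xr nx]]; first exact: continuous_spin.
have [M [d [d0 h]]] := dichotomy_local_bound dPsi (fun bl => nx (conj xr bl)).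
exists M, d; split => //; apply: filterS h => n h y /h.
by rewrite /spin ger0_norm// sqrtr_ge0.
Qed.

Definition locally_bounded x := exists M d : R, 0 < d /\
  \forall n \near \oo, forall y, box x d y -> `|u n y| <= M.
Definition locally_to_minfty x := exists2 d : R, 0 < d & forall M,
  \forall n \near \oo, forall y, box x d y -> u n y < M.

(** The dichotomy for [- u] on one rational square within the range of Harnack's inequality decides.
    Either [u] is eventually bounded below there, or its infimum over that square tends to minus
    infinity and Harnack's inequality carries this to every nearby point. *)
Lemma local_alternative x : disc r x -> ~ Sigma1 r u x ->
  locally_bounded x \/ locally_to_minfty x.
Proof.
move=> xr nx.
have [M [d1 [d10 ub]]] := dichotomy_local_bound du (fun bl => nx (conj xr bl)).
have [e e0 eB] := box_in_disc xr.
pose d := Num.min d1 e; have d0 : 0 < d by rewrite lt_min d10.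
have [dd1 de] : d <= d1 /\ d <= e by rewrite /d !ge_min !lexx orbT.
have sub : box x d `<=` disc r by move=> z /(box_subr de); exact: eB.
have [N NP] := uniform_spin_bound M d0 sub.
have d20 : 0 < d / 2 by rewrite divr_gt0.
have subd : box x (d / 2) `<=` box x d by apply: box_subr; lra.
(* The spinor bound is available on the half square only, so Harnack's inequality is applied with
   [d / 2] in place of [d]. *)
pose K := 5000 * ((2 * b ^+ 2 * weight_bound r A * expR (2 * M) +
  b * weight_bound r A * expR M * N ^+ 2) * (d / 2) ^+ 2).
have harnack : \forall n \near \oo, forall y z, box x (d / 2 / 32) y -> box x (d / 2 / 32) z ->
    M - u n y <= 64 * (M - u n z) + K.
  apply: filterS ub => n ub.
  have ub' z : box x d z -> u n z <= M by move=> /(box_subr dd1); exact: ub.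
  apply: (solution_Harnack r0 a0 Vab (alA n) (sol n) d20).
  - by move=> z /subd; exact: sub.
  - by move=> z /subd; exact: ub'.
  - exact: NP ub'.
have d30 : 0 < d / 2 / 32 by rewrite divr_gt0// ltr0n.
have [j [xj jd]] := rbox_base (nbhs_box x d30).
have jd2 : rbox j `<=` box x d1.
  move=> z /jd h; apply: box_subr dd1 _ _; apply: subd; apply: box_subr h; lra.
have [[M' M'P]|none] := dNu j.
  left; have /nbhs_boxP[d' d'0 d'j] := xj; exists (`|M| + `|M'|), d'; split => //.
  apply: filterS2 ub M'P => n h1 h2 y /d'j yj.
  have := h1 _ (jd2 _ yj); have := h2 _ yj.
  have := ler_norm M; have := ler_norm M'; have := normr_ge0 M; have := normr_ge0 M'.
  by rewrite ler_norml; move: (u n y) `|M| `|M'| => t m m' *; apply/andP; split; lra.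
right; exists (d / 2 / 32) => // L.
(* If [u n y >= L] at one point, Harnack's inequality bounds [- u n] on the whole rational square by
   this number, against the second alternative. *)
apply: filterS2 harnack (none (64 * (M - L) + K - M)) => n har nb y yB.
rewrite ltNge; apply/negP => Ly; apply: nb => z zj.
by have := har z y (jd _ zj) yB; lra.
Qed.

Lemma locally_bounded_open : open locally_bounded.
Proof.
rewrite openE => x [M [d [d0 h]]]; apply/nbhs_boxP; exists (d / 2); first by rewrite divr_gt0.
move=> y yB; exists M, (d / 2); split; first by rewrite divr_gt0.
apply: filterS h => n h z zB; apply: h; move/boxP: yB => [y1 y2].
by apply: sub_box zB; rewrite [leRHS]splitr lerD2r.
Qed.

Lemma locally_to_minfty_open : open locally_to_minfty.
Proof.
rewrite openE => x [d d0 h]; apply/nbhs_boxP; exists (d / 2); first by rewrite divr_gt0.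
move=> y yB; exists (d / 2) => [|M]; first by rewrite divr_gt0.
apply: filterS (h M) => n hM z zB; apply: hM; move/boxP: yB => [y1 y2].
by apply: sub_box zB; rewrite [leRHS]splitr lerD2r.
Qed.

Lemma bounded_minfty_disjoint x : locally_bounded x -> locally_to_minfty x -> False.
Proof.
move=> [M [d [d0 h]]] [e e0 /(_ (- M)) h'].
have [n [n1 n2]] := filter_ex (filterI h h').
have := n1 x (box_center _ (ltW d0)); have := n2 x (box_center _ (ltW e0)).
by rewrite ler_norml => + /andP[]; lra.
Qed.

(** Off the finite set [Sigma1] the two local behaviours define disjoint open sets that cover the
    rest of the disc, so one locally bounded point forces local boundedness everywhere. *)
Lemma global_alternative :
  bounded_loc (disc r `\` Sigma1 r u) u \/ to_minfty_loc (disc r `\` Sigma1 r u) u.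
Proof.
have [s sE] := (finite_seqP _).1 Sigma1_finite.
have cov y : disc r y -> y \notin s -> locally_bounded y \/ locally_to_minfty y.
  move=> yr ys; apply: local_alternative => // Sy.
  by move: Sy ys; rewrite sE /= => ->.
have [[x [[xr nx] Bx]]|none] := pselect (exists x, (disc r `\` Sigma1 r u) x /\ locally_bounded x).
  left; apply: bounded_loc_local => [n q [qr _]|y [yr ny]]; first exact: continuous_solution.
  move: nx ny; rewrite sE /= => /negP nx /negP ny.
  have [//|Ty] := cov y yr ny.
  by case: (disc_minus_finite_connected r0 locally_bounded_open locally_to_minfty_open
    bounded_minfty_disjoint cov xr yr nx ny Bx Ty).
right; apply: to_minfty_loc_local => y [yr ny].
have [By|//] := local_alternative yr ny.
by case: none; exists y.
Qed.

End Sequences.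

Theorem theorem1p1 (R : realType) (r : R) (V : R * R -> R)
    (a b beta C alpha : R) (alphas : nat -> R)
    (u : nat -> R * R -> R) (Psi : nat -> R * R -> R[i] * R[i]) :
  0 < r ->
  0 < C ->
  (forall n, 0 < alphas n) -> alphas @ \oo --> alpha -> 0 <= alpha ->
  0 < beta <= 1 -> C1beta_on (disc r) beta V ->
  0 < a -> (forall x, disc r x -> a <= V x <= b) ->
  (forall n, is_solution r V (alphas n) (u n) (Psi n)) ->
  (forall n, (\int[@leb2 R]_(x in disc r)
                (wt (2 * alphas n) x * expR (2 * u n x))%:E < C%:E)%E) ->
  (forall n, (\int[@leb2 R]_(x in disc r)
                (spin_sq (Psi n x) ^+ 2)%:E < C%:E)%E) ->
  Sigma2 r Psi `<=` Sigma1 r u /\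
  exists phi : nat -> nat,
    (forall m n, (m < n)%N -> (phi m < phi n)%N) /\
    let u' := fun n => u (phi n) in
    let Psi' := fun n => Psi (phi n) in
    (* a) *)
    bounded_loc (disc r `\` Sigma2 r Psi') (fun n x => spin_norm (Psi' n x)) /\
    (* b) *)
    [\/ bounded_loc (disc r) u',
        to_minfty_loc (disc r) u' |
        [/\ finite_set (Sigma1 r u'), Sigma1 r u' !=set0 &
            (bounded_loc (disc r `\` Sigma1 r u') u' \/
             to_minfty_loc (disc r `\` Sigma1 r u') u')]].

Proof.
move=> r0 _ al0 cal _ _ _ a0 Vab sol eu eP.
(* Convergence of the exponents enters through their boundedness: all constants depend on the common
   bound [A + 1]. *)
have [A [_ alA']] := cvg_seq_bounded (cvgP _ cal).
have alA n : 0 < alphas n <= A + 1.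
  rewrite al0/=; apply: le_trans (ler_norm _) _.
  by apply: (alA' (A + 1)) => //; rewrite ltrDl.
split; first exact: (Sigma2_sub_Sigma1 r0 a0 Vab alA sol eP).
(* The three families are merged into one, indexed by ['I_3], so that a single extraction provides
   the dichotomy for each of them. *)
pose G (k : 'I_3) n x : R := if k == ord0 then u n x
  else if k == ord_max then - u n x else spin_norm (Psi n x).
have [phi [mono dich]] := @diagonal_subsequence R _
  (fun j : (rat * rat * nat) * 'I_3 => fun M n => forall y, rbox j.1 y -> G j.2 n y <= M).
exists phi; split => // u' Psi'.
have alA'' n : 0 < alphas (phi n) <= A + 1 by [].
have sol' n : is_solution r V (alphas (phi n)) (u' n) (Psi' n) by exact: sol.
have eu' n := eu (phi n); have eP' n := eP (phi n).
have du : box_dichotomy u' by move=> j; exact: (dich (j, ord0)).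
have dN : box_dichotomy (fun n x => - u' n x) by move=> j; exact: (dich (j, ord_max)).
have dP : box_dichotomy (fun n x => spin_norm (Psi' n x)).
  by move=> j; exact: (dich (j, Ordinal (isT : 1 < 3)%N)).
split; first exact: (spin_bounded_off_Sigma2 sol' dP).
have fin := Sigma1_finite r0 a0 Vab alA'' sol' eu'.
have alt := global_alternative r0 a0 Vab alA'' sol' eu' eP' du dN.
(* With no blow-up point the alternative off [Sigma1] is an alternative on the whole disc, which is
   case i) or ii). *)
have [S0|/set0P Sn] := eqVneq (Sigma1 r u') set0.
  by move: alt; rewrite S0 setD0 => -[h|h]; [exact: Or31|exact: Or32].
by apply: Or33; split.
Qed.
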